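(* Let $R$ be a commutative noetherian ring with identity that is Cohen-Macaulay and has a dualizing module $D$. Assume that $R$ is generically Gorenstein. If $G$ and $H$ are Gorenstein injective $R$-modules, then $G\otimes_R H$ is also a Gorenstein injective $R$-module.
   Context: A dualizing module for $R$ is a finitely generated $R$-module $D$ of finite injective dimension such that the homothety map $R\to\operatorname{Hom}_R(D,D)$ is an isomorphism and $\operatorname{Ext}^i_R(D,D)=0$ for all $i\ge1$. $R$ is generically Gorenstein if the localization $R_{\mathfrak p}$ is Gorenstein for every minimal prime $\mathfrak p$ of $R$. An $R$-module $G$ is Gorenstein injective if there is an exact sequence of injective $R$-modules $E=\cdots\to E_1\to E_0\to E^0\to E^1\to\cdots$ such that $\operatorname{Hom}_R(I,E)$ is exact for every injective $R$-module $I$ and $G\cong\operatorname{Im}(E_0\to E^0)$. *)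

(* Defs.v *)
From HB Require Import structures.
From mathcomp Require Import all_boot all_order all_algebra.
From mathcomp Require Import ring.
From mathcomp Require Import boolp.

Set Implicit Arguments.
Unset Strict Implicit.
Unset Printing Implicit Defensive.

Import GRing.Theory.
Local Open Scope ring_scope.
Local Open Scope quotient_scope.

(* Commutative rings are [comPzRingType], so the zero ring is allowed.
   Subsets are [{pred R}]: classically every subset has a characteristic
   function, so no decidability restriction is involved. *)

Definition span (R : comPzRingType) (M : lmodType R) (s : seq M) (x : M) : Prop :=
  exists c : 'I_(size s) -> R, x = \sum_(i < size s) c i *: s`_i.

Definition finitely_generated (R : comPzRingType) (M : lmodType R) : Prop :=
  exists s : seq M, forall x, span s x.

Definition is_ideal (R : comPzRingType) (I : {pred R}) : Prop :=
  submod_closed (I : {pred R^o}).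

Definition noetherian (R : comPzRingType) : Prop :=
  forall I : {pred R}, is_ideal I ->
    exists s : seq R^o, forall x, x \in I <-> span s x.

Definition is_prime (R : comPzRingType) (p : {pred R}) : Prop :=
  [/\ is_ideal p, 1 \notin p
    & forall a b, a * b \in p -> (a \in p) || (b \in p)].

Record prime_ideal (R : comPzRingType) := PrimeIdeal {
  prime_pred :> {pred R};
  prime_idealP : is_prime prime_pred
}.

Definition minimal_prime (R : comPzRingType) (p : prime_ideal R) : Prop :=
  forall q : prime_ideal R, {subset q <= p} -> {subset p <= q}.

Definition prime_chain (R : comPzRingType) (n : nat) : Prop :=
  exists c : 'I_n.+1 -> prime_ideal R, forall i j : 'I_n.+1, (i < j)%N ->
    {subset c i <= c j} /\ ~ {subset c j <= c i}.

(* [n.+1] suffices in the second clause: chains can be truncated. *)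
Definition krull_dim (R : comPzRingType) (n : nat) : Prop :=
  prime_chain R n /\ ~ prime_chain R n.+1.

Section Localization.
Variables (R : comPzRingType) (p : prime_ideal R).

Definition denom := {s : R | s \notin p}.
Definition fraction := (R * denom)%type.

Definition frac_eq (u v : fraction) : bool :=
  `[< exists2 t, t \notin p & t * (u.1 * val v.2) = t * (v.1 * val u.2) >].

Lemma denom1P : 1 \notin p. Proof. by case: (prime_idealP p). Qed.

Lemma denomMP a b : a \notin p -> b \notin p -> a * b \notin p.
Proof.
case: (prime_idealP p) => _ _ pP pa pb.
by apply/negP => /pP; rewrite (negPf pa) (negPf pb).
Qed.

Definition denom1 : denom := exist _ 1 denom1P.
Definition denomM (s t : denom) : denom :=
  exist _ (val s * val t) (denomMP (valP s) (valP t)).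

Lemma frac_eq_refl : reflexive frac_eq.
Proof. by move=> u; apply/asboolP; exists 1 => //; apply: denom1P. Qed.

Lemma frac_eq_sym : symmetric frac_eq.
Proof.
by move=> u v; apply/asboolP/asboolP => -[t pt e]; exists t.
Qed.

Lemma frac_eq_trans : transitive frac_eq.
Proof.
move=> [b [y py]] [a [x px]] [c [z pz]] /asboolP[/= t pt e] /asboolP[/= u pu f].
apply/asboolP; exists (t * u * y) => /=; first by rewrite !denomMP.
have -> : t * u * y * (a * z) = u * z * (t * (a * y)) by ring.
rewrite e; have -> : u * z * (t * (b * x)) = t * x * (u * (b * z)) by ring.
rewrite f; ring.
Qed.

Canonical frac_equiv : equiv_rel fraction :=
  EquivRel frac_eq frac_eq_refl frac_eq_sym frac_eq_trans.

Definition localization := {eq_quot frac_equiv}.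
HB.instance Definition _ := EqQuotient.on localization.
HB.instance Definition _ := Choice.on localization.

Definition loc_frac (a : R) (s : denom) : localization :=
  \pi_localization (a, s).

Lemma loc_fracP a s b t :
  loc_frac a s = loc_frac b t <->
  exists2 u, u \notin p & u * (a * val t) = u * (b * val s).
Proof.
split; first by move=> /eqmodP /asboolP.
by move=> e; apply/eqmodP/asboolP.
Qed.

Lemma loc_fracE (x : localization) : x = loc_frac (repr x).1 (repr x).2.
Proof. by rewrite /loc_frac -surjective_pairing reprK. Qed.

Definition loc_zero : localization := loc_frac 0 denom1.
Definition loc_one : localization := loc_frac 1 denom1.
Definition loc_opp (x : localization) : localization :=
  loc_frac (- (repr x).1) (repr x).2.
Definition loc_add (x y : localization) : localization :=
  loc_frac ((repr x).1 * val (repr y).2 + (repr y).1 * val (repr x).2)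
           (denomM (repr x).2 (repr y).2).
Definition loc_mul (x y : localization) : localization :=
  loc_frac ((repr x).1 * (repr y).1) (denomM (repr x).2 (repr y).2).

Lemma loc_ind (P : localization -> Prop) :
  (forall a s, P (loc_frac a s)) -> forall x, P x.
Proof. by move=> H x; rewrite [x]loc_fracE. Qed.

Lemma loc_repr a s : exists2 u, u \notin p &
  u * ((repr (loc_frac a s)).1 * val s) =
  u * (a * val (repr (loc_frac a s)).2).
Proof. by apply/loc_fracP; rewrite -loc_fracE. Qed.

Lemma loc_oppE a s : loc_opp (loc_frac a s) = loc_frac (- a) s.
Proof.
have [u pu e] := loc_repr a s; apply/loc_fracP; exists u => //.
by rewrite !mulNr !mulrN e.
Qed.

Lemma loc_addE a s b t : loc_add (loc_frac a s) (loc_frac b t) =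
  loc_frac (a * val t + b * val s) (denomM s t).
Proof.
have [u pu e] := loc_repr a s; have [v pv f] := loc_repr b t.
rewrite /loc_add; move: (repr _) (repr _) e f => [b' [t' pt']] [a' [s' ps']] /=.
case: s t => [s ps] [t pt] /= e f.
apply/loc_fracP; exists (u * v) => /=; first exact: denomMP.
transitivity (t * t' * v * (u * (a' * s)) + s * s' * u * (v * (b' * t))).
  ring.
rewrite e f; ring.
Qed.

Lemma loc_mulE a s b t : loc_mul (loc_frac a s) (loc_frac b t) =
  loc_frac (a * b) (denomM s t).
Proof.
have [u pu e] := loc_repr a s; have [v pv f] := loc_repr b t.
rewrite /loc_mul; move: (repr _) (repr _) e f => [b' [t' pt']] [a' [s' ps']] /=.
case: s t => [s ps] [t pt] /= e f.
apply/loc_fracP; exists (u * v) => /=; first exact: denomMP.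
transitivity ((u * (a' * s)) * (v * (b' * t))); first ring.
rewrite e f; ring.
Qed.

Lemma loc_frac_eq a s b t :
  a * val t = b * val s -> loc_frac a s = loc_frac b t.
Proof.
by move=> e; apply/loc_fracP; exists 1; [exact: denom1P | rewrite e].
Qed.

Lemma loc_addA : associative loc_add.
Proof.
elim/loc_ind=> a s; elim/loc_ind=> b t; elim/loc_ind=> c u.
rewrite !loc_addE; apply: loc_frac_eq => /=; ring.
Qed.

Lemma loc_addC : commutative loc_add.
Proof.
elim/loc_ind=> a s; elim/loc_ind=> b t.
rewrite !loc_addE; apply: loc_frac_eq => /=; ring.
Qed.

Lemma loc_add0 : left_id loc_zero loc_add.
Proof. elim/loc_ind=> a s; rewrite loc_addE; apply: loc_frac_eq => /=; ring. Qed.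

Lemma loc_addN : left_inverse loc_zero loc_opp loc_add.
Proof.
elim/loc_ind=> a s; rewrite loc_oppE loc_addE; apply: loc_frac_eq => /=; ring.
Qed.

Lemma loc_mulA : associative loc_mul.
Proof.
elim/loc_ind=> a s; elim/loc_ind=> b t; elim/loc_ind=> c u.
rewrite !loc_mulE; apply: loc_frac_eq => /=; ring.
Qed.

Lemma loc_mulC : commutative loc_mul.
Proof.
elim/loc_ind=> a s; elim/loc_ind=> b t.
rewrite !loc_mulE; apply: loc_frac_eq => /=; ring.
Qed.

Lemma loc_mul1 : left_id loc_one loc_mul.
Proof. elim/loc_ind=> a s; rewrite loc_mulE; apply: loc_frac_eq => /=; ring. Qed.

Lemma loc_mulDl : left_distributive loc_mul loc_add.
Proof.
elim/loc_ind=> a s; elim/loc_ind=> b t; elim/loc_ind=> c u.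
rewrite loc_addE !loc_mulE loc_addE; apply: loc_frac_eq => /=; ring.
Qed.

HB.instance Definition _ := GRing.isZmodule.Build localization
  loc_addA loc_addC loc_add0 loc_addN.
HB.instance Definition _ := GRing.Zmodule_isComPzRing.Build localization
  loc_mulA loc_mulC loc_mul1 loc_mulDl.
End Localization.

Section Injective.
Variable R : comPzRingType.
Implicit Types M N E : lmodType R.

Definition injective_module E : Prop :=
  forall (A B : lmodType R) (i : {linear A -> B}) (f : {linear A -> E}),
    injective i -> exists g : {linear B -> E}, forall x, g (i x) = f x.

Definition exact (A B C : lmodType R) (f : A -> B) (g : B -> C) : Prop :=
  forall y, g y = 0 <-> exists x, f x = y.

(* Exactness of Hom(M, A) -> Hom(M, B) -> Hom(M, C) at Hom(M, B). *)
Definition hom_exact M (A B C : lmodType R)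
    (f : {linear A -> B}) (g : {linear B -> C}) : Prop :=
  forall h : {linear M -> B},
    (forall x, g (h x) = 0) <->
    exists k : {linear M -> A}, forall x, f (k x) = h x.

(* 0 -> M -> I^0 -> I^1 -> ... *)
Record injective_resolution M := InjectiveResolution {
  res_obj : nat -> lmodType R;
  res_aug : {linear M -> res_obj 0};
  res_diff : forall n, {linear res_obj n -> res_obj n.+1};
  res_injective : forall n, injective_module (res_obj n);
  res_aug_inj : injective res_aug;
  res_exact0 : exact res_aug (res_diff 0);
  res_exact : forall n, exact (res_diff n) (res_diff n.+1)
}.

Definition finite_injdim M : Prop :=
  exists (I : injective_resolution M) (n : nat),
    forall k, (n < k)%N -> forall x : res_obj I k, x = 0.

(* Ext^{n+1}(M, N) = 0, where Ext^{n+1}(M, N) is the cohomology of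
   Hom(M, I^n) -> Hom(M, I^{n+1}) -> Hom(M, I^{n+2}) for an injective
   resolution I of N; it does not depend on the choice of I. *)
Definition ext_succ_eq0 (n : nat) M N : Prop :=
  forall I : injective_resolution N,
    hom_exact M (res_diff I n) (res_diff I n.+1).

Definition dualizing_module (D : lmodType R) : Prop :=
  [/\ finitely_generated D,
      finite_injdim D,
      forall f : {linear D -> D}, exists! r : R, forall x, f x = r *: x
    & forall n, ext_succ_eq0 n D D].

(* [E i] is in cohomological degree [i]: E_0 sits in degree -1 and E^0 in
   degree [-1 + 1]. An isomorphism of G with the image is given as an
   injective linear map into E^0 with the same image. *)
Definition gorenstein_injective (G : lmodType R) : Prop :=
  exists (E : int -> lmodType R) (d : forall i, {linear E i -> E (i + 1)}),
  [/\ forall i, injective_module (E i),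
      forall i, exact (d i) (d (i + 1)),
      forall I, injective_module I ->
        forall i, hom_exact I (d i) (d (i + 1))
    & exists2 u : {linear G -> E (-1 + 1)}, injective u &
        forall y, (exists x, u x = y) <-> (exists x, d (-1) x = y)].
End Injective.

(* Meaningful for local rings only. *)
Definition gorenstein_local (A : comPzRingType) : Prop := finite_injdim A^o.

Definition generically_gorenstein (R : comPzRingType) : Prop :=
  forall p : prime_ideal R, minimal_prime p -> gorenstein_local (localization p).

Definition regular_sequence (A : comPzRingType) (s : seq A^o) : Prop :=
  (forall i, (i < size s)%N -> forall a : A,
     span (take i s) (s`_i * a) -> span (take i s) a) /\
  ~ span s 1.

(* In a local ring a sequence generates a proper ideal iff its terms lie in
   the maximal ideal, so this is the depth of a noetherian local ring. *)
Definition local_depth (A : comPzRingType) (n : nat) : Prop :=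
  (exists2 s : seq A^o, regular_sequence s & size s = n) /\
  (forall s : seq A^o, regular_sequence s -> (size s <= n)%N).

Definition cohen_macaulay (R : comPzRingType) : Prop :=
  forall p : prime_ideal R, exists2 n,
    krull_dim (localization p) n & local_depth (localization p) n.

Definition bilinear_map (R : comPzRingType) (G H M : lmodType R)
    (b : G -> H -> M) : Prop :=
  (forall h, linear (b^~ h)) /\ (forall g, linear (b g)).

Section Tensor.
Variables (R : comPzRingType) (G H : lmodType R).

(* The list [:: (g1, h1); ...; (gn, hn)] stands for the sum of the gi (x) hi;
   two such sums are equal iff every bilinear map identifies them
   ([tensor_universal] below). *)
Definition tsum (M : lmodType R) (b : G -> H -> M) (s : seq (G * H)) : M :=
  \sum_(x <- s) b x.1 x.2.

Definition tensor_eq (s t : seq (G * H)) : bool :=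
  `[< forall (M : lmodType R) (b : G -> H -> M),
        bilinear_map b -> tsum b s = tsum b t >].

Lemma tensor_eq_refl : reflexive tensor_eq.
Proof. by move=> s; apply/asboolP. Qed.

Lemma tensor_eq_sym : symmetric tensor_eq.
Proof. by move=> s t; apply/asboolP/asboolP => e M b /e. Qed.

Lemma tensor_eq_trans : transitive tensor_eq.
Proof.
by move=> t s u /asboolP e /asboolP f; apply/asboolP => M b bP; rewrite e ?f.
Qed.

Canonical tensor_equiv : equiv_rel (seq (G * H)) :=
  EquivRel tensor_eq tensor_eq_refl tensor_eq_sym tensor_eq_trans.

Definition tensor := {eq_quot tensor_equiv}.
HB.instance Definition _ := EqQuotient.on tensor.
HB.instance Definition _ := Choice.on tensor.

Definition tensor_lift (M : lmodType R) (b : G -> H -> M) (x : tensor) : M :=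
  tsum b (repr x).

Lemma tensor_lift_pi (M : lmodType R) (b : G -> H -> M) s :
  bilinear_map b -> tensor_lift b (\pi_tensor s) = tsum b s.
Proof.
move=> bP; have /eqmodP/asboolP e : \pi_tensor (repr (\pi_tensor s)) = \pi s.
  by rewrite reprK.
exact: e.
Qed.

Lemma tensorP (x y : tensor) :
  (forall (M : lmodType R) (b : G -> H -> M), bilinear_map b ->
     tensor_lift b x = tensor_lift b y) -> x = y.
Proof.
by move=> e; rewrite -[x]reprK -[y]reprK; apply/eqmodP/asboolP.
Qed.

Definition tensor_zero : tensor := \pi_tensor [::].
Definition tensor_add (x y : tensor) : tensor := \pi_tensor (repr x ++ repr y).
Definition tensor_scale (a : R) (x : tensor) : tensor :=
  \pi_tensor [seq (a *: u.1, u.2) | u <- repr x].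
Definition tensor_opp (x : tensor) : tensor := tensor_scale (-1) x.

Section Lift.
Variables (M : lmodType R) (b : G -> H -> M) (bP : bilinear_map b).

Lemma bilinear_scalel a g h : b (a *: g) h = a *: b g h.
Proof.
have b0 : b 0 h = 0.
  by have := bP.1 h (-1) 0 0; rewrite /= scaler0 addr0 scaleN1r addNr.
by have := bP.1 h a g 0; rewrite /= b0 !addr0.
Qed.

Lemma tensor_lift0 : tensor_lift b tensor_zero = 0.
Proof. by rewrite tensor_lift_pi // /tsum big_nil. Qed.

Lemma tensor_liftD x y :
  tensor_lift b (tensor_add x y) = tensor_lift b x + tensor_lift b y.
Proof. by rewrite tensor_lift_pi // /tsum big_cat. Qed.

Lemma tensor_liftZ a x :
  tensor_lift b (tensor_scale a x) = a *: tensor_lift b x.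
Proof.
rewrite tensor_lift_pi // /tsum big_map scaler_sumr.
by apply: eq_bigr => u _; rewrite bilinear_scalel.
Qed.

Lemma tensor_liftN x : tensor_lift b (tensor_opp x) = - tensor_lift b x.
Proof. by rewrite tensor_liftZ scaleN1r. Qed.
End Lift.

Lemma tensor_addA : associative tensor_add.
Proof.
by move=> x y z; apply: tensorP => M b bP; rewrite !tensor_liftD // addrA.
Qed.

Lemma tensor_addC : commutative tensor_add.
Proof.
by move=> x y; apply: tensorP => M b bP; rewrite !tensor_liftD // addrC.
Qed.

Lemma tensor_add0 : left_id tensor_zero tensor_add.
Proof.
by move=> x; apply: tensorP => M b bP; rewrite tensor_liftD // tensor_lift0 // add0r.
Qed.

Lemma tensor_addN : left_inverse tensor_zero tensor_opp tensor_add.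
Proof.
move=> x; apply: tensorP => M b bP.
by rewrite tensor_liftD // tensor_liftN // tensor_lift0 // addNr.
Qed.

HB.instance Definition _ := GRing.isZmodule.Build tensor
  tensor_addA tensor_addC tensor_add0 tensor_addN.

Lemma tensor_scaleA a c x :
  tensor_scale a (tensor_scale c x) = tensor_scale (a * c) x.
Proof.
by apply: tensorP => M b bP; rewrite !tensor_liftZ // scalerA.
Qed.

Lemma tensor_scale1 : left_id 1 tensor_scale.
Proof. by move=> x; apply: tensorP => M b bP; rewrite tensor_liftZ // scale1r. Qed.

Lemma tensor_scaleDr : right_distributive tensor_scale +%R.
Proof.
move=> a x y; apply: tensorP => M b bP.
by rewrite !(tensor_liftZ, tensor_liftD) // scalerDr.
Qed.

Lemma tensor_scaleDl x : {morph tensor_scale^~ x : a c / a + c}.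
Proof.
move=> a c; apply: tensorP => M b bP.
by rewrite !(tensor_liftZ, tensor_liftD) // scalerDl.
Qed.

HB.instance Definition _ := GRing.Zmodule_isLmodule.Build R tensor
  tensor_scaleA tensor_scale1 tensor_scaleDr tensor_scaleDl.

Definition tens (g : G) (h : H) : tensor := \pi_tensor [:: (g, h)].

Lemma tensor_lift_tens (M : lmodType R) (b : G -> H -> M) g h :
  bilinear_map b -> tensor_lift b (tens g h) = b g h.
Proof. by move=> bP; rewrite tensor_lift_pi // /tsum big_seq1. Qed.

Lemma tens_bilinear : bilinear_map tens.
Proof.
split=> [h a g g' | g a h h']; apply: tensorP => M b bP;
  rewrite tensor_liftD // tensor_liftZ // !tensor_lift_tens //.
- exact: bP.1.
- exact: bP.2.
Qed.

Lemma tensor_lift_linear (M : lmodType R) (b : G -> H -> M) :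
  bilinear_map b -> linear (tensor_lift b).
Proof. by move=> bP a x y; rewrite tensor_liftD // tensor_liftZ. Qed.

Lemma tensor_sumE (x : tensor) : x = tsum tens (repr x).
Proof.
have tD := tens_bilinear; apply: tensorP => M b bP.
rewrite {1}/tensor_lift; elim: (repr x) => [|u s IHs].
  by rewrite /tsum !big_nil tensor_lift0.
by rewrite /tsum !big_cons tensor_liftD // tensor_lift_tens // -IHs.
Qed.

Lemma tensor_universal (M : lmodType R) (b : G -> H -> M) :
  bilinear_map b ->
  exists f : {linear tensor -> M}, (forall g h, f (tens g h) = b g h) /\
    forall f' : {linear tensor -> M},
      (forall g h, f' (tens g h) = b g h) -> f' =1 f.
Proof.
move=> bP.
pose L := GRing.isLinear.Build R tensor M *:%R (tensor_lift b)
            (tensor_lift_linear bP).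
pose f : {linear tensor -> M} := HB.pack (tensor_lift b) L.
exists f; split=> [g h | f' f'E x]; first exact: tensor_lift_tens.
rewrite [x]tensor_sumE /tsum !linear_sum; apply: eq_bigr => u _.
by rewrite f'E; apply/esym/tensor_lift_tens.
Qed.
End Tensor.

(* Main.v *)
Require Import Defs.
From HB Require Import structures.
From mathcomp Require Import all_boot all_order all_algebra.
From mathcomp Require Import ring.
From mathcomp Require Import boolp classical_sets.

Set Implicit Arguments.
Unset Strict Implicit.
Unset Printing Implicit Defensive.

Import GRing.Theory.
Local Open Scope ring_scope.
Local Open Scope quotient_scope.

(** Let [S] be the set of elements outside all minimal primes.  Since [R] is
    Cohen-Macaulay, the elements of [S] are regular, so they act surjectively on
    the Gorenstein injective modules [G] and [H]; and if [s g = 0] then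
    [g (x) h = g (x) s h' = 0], so they act bijectively on the tensor product.
    Hence the tensor product is a finite product of modules over the rings [R_p]
    with [p] minimal.  Each [R_p] is a local artinian ring of finite injective
    dimension, hence self-injective, so free [R_p]-modules and products of copies
    of [R_p] are injective and every [R_p]-module [M] has an exact complex of
    these around it.  That complex stays exact under [Hom(I, -)] for every
    injective [R]-module [I], because [I_p] behaves like a free [R_p]-module. *)

(** * Submodules, partial linear maps and Baer's criterion *)

(** Self-injectivity of [R_p] is obtained without Ext. A nonzero element [sigma] killed by the
    maximal ideal [m] has annihilator exactly [m], so in an injective module every element killed by
    [m] is a multiple of [sigma]. Carrying this fact down a finite injective resolution shows that
    [R_p] passes Baer's test on [m], and nilpotency of [m] makes that single test sufficient.

    The delicate point is the lifting of maps out of [I_p]. Instead of a structure theory of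
    injective modules, Baer's criterion for [I] gives directly that an element of [I_p] killed by
    the socle of [R_p] lies in [m I_p]; this is the one property of free modules that the lifting
    uses.

    The ring [R] itself need not split into its localizations. The minimal primes are only separated
    by orthogonal elements [a i], and sums [\sum_j a j * b j] turn elements outside the single
    primes into one element outside all of them. Localized modules are not built from fractions: on
    the modules concerned, elements outside [p] act surjectively up to torsion, so the quotient by
    the torsion is already the localization. *)

Definition linear_of (R : comPzRingType) (U V : lmodType R) (f : U -> V)
    (fL : linear f) : {linear U -> V} :=
  HB.pack f (GRing.isLinear.Build R U V *:%R f fL).

Section Submodules.
Variables (R : comPzRingType) (M : lmodType R).

Definition submodule (P : M -> Prop) : Prop :=
  P 0 /\ forall a x y, P x -> P y -> P (a *: x + y).

Section Closure.
Variables (P : M -> Prop) (PP : submodule P).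

Lemma submod0 : P 0. Proof. exact: PP.1. Qed.

Lemma submodZ a x : P x -> P (a *: x).
Proof. by move=> Px; rewrite -[_ *: _]addr0; apply: PP.2 => //; apply: submod0. Qed.

Lemma submodD x y : P x -> P y -> P (x + y).
Proof. by move=> Px Py; rewrite -[x]scale1r; apply: PP.2. Qed.

Lemma submodN x : P x -> P (- x).
Proof. by move=> Px; rewrite -scaleN1r; apply: submodZ. Qed.

Lemma submodB x y : P x -> P y -> P (x - y).
Proof. by move=> Px Py; apply: submodD => //; apply: submodN. Qed.

Lemma submod_sum (I : Type) (r : seq I) (F : I -> M) :
  (forall i, P (F i)) -> P (\sum_(i <- r) F i).
Proof.
by move=> PF; elim/big_rec: _ => [|i x _ Px]; [apply: submod0 | apply: submodD].
Qed.

Definition submodule_pred of submodule P : {pred M} := fun x => `[< P x >].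

Lemma submodule_predP : submod_closed (submodule_pred PP).
Proof.
split; first by apply/asboolP/submod0.
by move=> a x y /asboolP Px /asboolP Py; apply/asboolP/PP.2.
Qed.
HB.instance Definition _ :=
  GRing.isSubmodClosed.Build R M (submodule_pred PP) submodule_predP.

Definition submodule_type := {x : M | submodule_pred PP x}.
HB.instance Definition _ := SubChoice.on submodule_type.
HB.instance Definition _ := [SubChoice_isSubLmodule of submodule_type by <:].

Lemma submodule_typeP (x : submodule_type) : P (val x).
Proof. by case: x => x /= /asboolP. Qed.

Definition submodule_sub x (Px : P x) : submodule_type :=
  exist _ x (introT (asboolP (P x)) Px).
End Closure.
End Submodules.

Section Kernel.
Variables (R : comPzRingType) (U V : lmodType R) (f : {linear U -> V}).
Lemma submodule_ker : submodule (fun x => f x = 0).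
Proof.
by split=> [|a x y fx fy]; rewrite ?linear0 // linearP fx fy scaler0 addr0.
Qed.
Lemma submodule_im : submodule (fun y => exists x, f x = y).
Proof.
split=> [|a _ _ [x <-] [y <-]]; first by exists 0; rewrite linear0.
by exists (a *: x + y); rewrite linearP.
Qed.
End Kernel.

(** * Linear maps as graphs, and their extension by Zorn's lemma *)

Section Graphs.
Variable R : comPzRingType.
Implicit Types B E : lmodType R.

(** Graph of a linear map defined on a submodule of [B]; given linearity, the last clause is
    single-valuedness. With graphs, extension is inclusion and the domain needs no type of its
    own. *)
Definition partial_linear B E (G : B -> E -> Prop) : Prop :=
  [/\ G 0 0,
      forall a b e b' e', G b e -> G b' e' -> G (a *: b + b') (a *: e + e')
    & forall e, G 0 e -> e = 0].

(** The property [Phi] stays arbitrary because it is used twice: for linear extensions, and for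
    lifts subject to a condition on their domain. *)
Lemma graph_zorn (B E : Type) (Phi : (B -> E -> Prop) -> Prop)
    (G0 : B -> E -> Prop) :
  Phi G0 -> (exists b e, G0 b e) ->
  (forall F : (B -> E -> Prop) -> Prop, (exists G, F G) ->
    (forall G, F G -> Phi G) ->
    (forall G G', F G -> F G' ->
       (forall b e, G b e -> G' b e) \/ (forall b e, G' b e -> G b e)) ->
    Phi (fun b e => exists2 G, F G & G b e)) ->
  exists G, [/\ Phi G, forall b e, G0 b e -> G b e &
    forall G', Phi G' -> (forall b e, G b e -> G' b e) ->
      forall b e, G' b e -> G b e].
Proof.
move=> Phi0 [b0 [e0 G00]] Phi_chain.
pose cur (X : set (B * E)) b e := X (b, e).
pose good (X : set (B * E)) :=
  Phi (cur X) /\ forall b e, G0 b e -> X (b, e).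
pose P (X : set (B * E)) := (forall x, ~ X x) \/ good X.
have [F FP Ftot|A [PA Amax]] := @Zorn_bigcup _ P.
  have [[X FX gX]|nX] := pselect (exists2 X, F X & good X); last first.
    left=> x [X FX Xx]; have [/(_ x)//|gX] := FP _ FX.
    by apply: nX; exists X.
  right; split; last by move=> b e /gX.2 Xbe; exists X.
  pose F' (G : B -> E -> Prop) := exists Y, [/\ F Y, good Y & G = cur Y].
  suff -> : cur (\bigcup_(Y in F) Y)%classic = fun b e => exists2 G, F' G & G b e.
    apply: Phi_chain.
    - by exists (cur X), X.
    - by move=> _ [Y [_ [gY _] ->]].
    - move=> _ _ [Y [FY _ ->]] [Z [FZ _ ->]].
      have [YZ|ZY] := Ftot _ _ FY FZ; first by left=> b e /YZ.
      by right=> b e /ZY.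
  apply/funext => b; apply/funext => e; apply/propext; split.
    case=> Y FY Ybe; exists (cur Y) => //; exists Y; split=> //.
    by have [/(_ (b, e))/(_ Ybe)|] := FP _ FY.
  by case=> _ [Y [FY _ ->]] Ybe; exists Y.
have good0 : good (fun x => G0 x.1 x.2) by split.
have gA : good A.
  case: PA => // A0; case: (Amax _ _ (or_intror good0)).
  by split=> [x /A0//|/(_ (b0, e0) G00)/A0].
exists (cur A); split; [exact: gA.1 | exact: gA.2 |].
move=> G' PhiG' AG' b e G'be; apply: contrapT => nA.
apply: (Amax (fun x => G' x.1 x.2)).
  by split=> [[x y] /AG'|/(_ (b, e))/(_ G'be)].
right; split=> // x y /gA.2; exact: AG'.
Qed.

Lemma partial_linear_chain B E (F : (B -> E -> Prop) -> Prop) :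
  (exists G, F G) -> (forall G, F G -> partial_linear G) ->
  (forall G G', F G -> F G' ->
     (forall b e, G b e -> G' b e) \/ (forall b e, G' b e -> G b e)) ->
  partial_linear (fun b e => exists2 G, F G & G b e).
Proof.
move=> [G FG] Flin Ftot; split.
- by exists G => //; have [] := Flin _ FG.
- move=> a b e b' e' [H FH Hbe] [K FK Kbe].
  have [HK|KH] := Ftot _ _ FH FK.
    by exists K => //; have [_ + _] := Flin _ FK; apply=> //; apply: HK.
  by exists H => //; have [_ + _] := Flin _ FH; apply=> //; apply: KH.
- by move=> e [H FH]; have [_ _] := Flin _ FH; apply.
Qed.

Section PartialLinear.
Variables (B E : lmodType R) (G : B -> E -> Prop) (GL : partial_linear G).

Lemma graph0 : G 0 0. Proof. by case: GL. Qed.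
Lemma graphZ a b e : G b e -> G (a *: b) (a *: e).
Proof.
case: GL => G0 GP _ Gbe.
by rewrite -[a *: b]addr0 -[a *: e]addr0; apply: GP.
Qed.
Lemma graphD b e b' e' : G b e -> G b' e' -> G (b + b') (e + e').
Proof.
case: GL => G0 GP _ Gbe Gbe'.
by rewrite -[b]scale1r -[e]scale1r; apply: GP.
Qed.
Lemma graphB b e b' e' : G b e -> G b' e' -> G (b - b') (e - e').
Proof.
by move=> Gbe Gbe'; rewrite -!(scaleN1r b') -!(scaleN1r e'); apply/graphD/graphZ.
Qed.
Lemma graph_fun b e e' : G b e -> G b e' -> e = e'.
Proof.
move=> Gbe Gbe'; apply/subr0_eq; have [_ _] := GL; apply.
by rewrite -[X in G X](subrr b); apply: graphB.
Qed.
Lemma submodule_dom : submodule (fun b => exists e, G b e).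
Proof.
split=> [|a x y [e Gx] [e' Gy]]; first by exists 0; apply: graph0.
by exists (a *: e + e'); apply: graphD => //; apply: graphZ.
Qed.

Lemma graph_map : (forall b, exists e, G b e) ->
  exists g : {linear B -> E}, forall b, G b (g b).
Proof.
move=> Gtot; pose g b := projT1 (cid (Gtot b)).
have gP b : G b (g b) by rewrite /g; case: cid.
have gL : linear g.
  move=> a x y; apply: (graph_fun (gP _)).
  by apply: graphD => //; apply: graphZ.
by exists (linear_of gL).
Qed.

Definition adjoin (b : B) (e : E) (x : B) (y : E) : Prop :=
  exists c x' y', [/\ G x' y', x = x' + c *: b & y = y' + c *: e].

Lemma adjoinW b e x y : G x y -> adjoin b e x y.
Proof. by exists 0, x, y; rewrite !scale0r !addr0. Qed.

Lemma adjoin_mem b e : adjoin b e b e.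
Proof. by exists 1, 0, 0; rewrite !scale1r !add0r; split=> //; apply: graph0. Qed.

Lemma adjoin_partial_linear b e :
  (forall c z, G (c *: b) z -> z = c *: e) -> partial_linear (adjoin b e).
Proof.
move=> Gb; split.
- exact/adjoinW/graph0.
- move=> a _ _ _ _ [c [x [y [Gxy -> ->]]]] [c' [x' [y' [Gxy' -> ->]]]].
  exists (a * c + c'), (a *: x + x'), (a *: y + y'); split.
  + by apply: graphD => //; apply: graphZ.
  + by rewrite scalerDr scalerDl scalerA addrACA.
  + by rewrite scalerDr scalerDl scalerA addrACA.
- move=> _ [c [x [y [Gxy e0 ->]]]].
  have xE : x = (- c) *: b by apply/eqP; rewrite scaleNr -addr_eq0 e0.
  by move: Gxy; rewrite xE => /Gb ->; rewrite scaleNr addNr.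
Qed.
End PartialLinear.

Lemma graph_maximal B E (G0 : B -> E -> Prop) : partial_linear G0 ->
  exists G, [/\ partial_linear G, forall b e, G0 b e -> G b e &
    forall b e, (forall c z, G (c *: b) z -> z = c *: e) -> G b e].
Proof.
move=> GL0.
have [||G [GL G0G Gmax]] := @graph_zorn _ _ _ G0 GL0.
- by exists 0, 0; apply: graph0.
- exact: partial_linear_chain.
exists G; split=> // b e Gb.
by apply: (Gmax _ (adjoin_partial_linear GL Gb) _ _ _ (adjoin_mem GL b e)) => *;
   apply: adjoinW.
Qed.

(** Baer's condition, a graph over [R^o] standing for a map defined on an ideal. *)
Definition ideal_injective E : Prop :=
  forall G : R^o -> E -> Prop, partial_linear G ->
    exists e, forall c z, G c z -> z = (c : R) *: e.

(** For a maximal extension [G'] and any [b], the relation [G' (c *: b) z] between [c] and [z] is a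
    map on an ideal, hence multiplication by some [e]; then [(b, e)] is consistent with [G'] and
    belongs to it. *)
Lemma ideal_injective_extend E B (G : B -> E -> Prop) :
  ideal_injective E -> partial_linear G ->
  exists g : {linear B -> E}, forall b e, G b e -> g b = e.
Proof.
move=> Einj GL; have [G' [GL' GG' Gmax]] := graph_maximal GL.
have [b|g gP] := graph_map GL'; last first.
  by exists g => b e /GG' /(graph_fun GL' (gP b)).
have [|e eP] := Einj (fun c z => G' (c *: b) z).
  split=> [|a c z c' z' Hz Hz'|z]; rewrite ?scale0r; first exact: graph0.
    by rewrite scalerDl -scalerA; apply: graphD => //; apply: graphZ.
  by case: GL' => _ _; apply.
by exists e; apply: Gmax.
Qed.

(** The graph itself, as a submodule of [B * E], is the source: its first projection is injective
    and its second is the map to extend. *)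
Lemma injective_extend E B (G : B -> E -> Prop) :
  injective_module E -> partial_linear G ->
  exists g : {linear B -> E}, forall b e, G b e -> g b = e.
Proof.
move=> Einj GL; pose P (x : B * E) := G x.1 x.2.
have PP : submodule P.
  by split=> [|a x y Px Py]; rewrite /P /=;
    [apply: graph0 | apply: graphD => //; apply: graphZ].
pose i (x : submodule_type PP) := (val x).1.
pose f (x : submodule_type PP) := (val x).2.
have iL : linear i by [].
have fL : linear f by [].
have iI : injective (linear_of iL).
  move=> [[x1 x2] Px] [[y1 y2] Py] /= e; apply: val_inj => /=.
  move: Px Py e; rewrite /i /= => /asboolP Px /asboolP Py e.
  by move: Px Py; rewrite /P /= e => Px /(graph_fun GL Px) ->.
have [g gP] := Einj _ _ (linear_of iL) (linear_of fL) iI.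
by exists g => b e Gbe; exact: (gP (submodule_sub PP (x := (b, e)) Gbe)).
Qed.

Lemma injective_moduleP E : injective_module E <-> ideal_injective E.
Proof.
split=> Einj.
  move=> G GL; have [g gP] := injective_extend Einj GL.
  exists (g 1) => c z /gP <-; rewrite -linearZ /=; congr (g _).
  by rewrite [RHS]mulr1.
move=> A B i f iI.
have [|g gP] := @ideal_injective_extend E B
    (fun b e => exists a, b = i a /\ e = f a) Einj.
  split.
  - by exists 0; rewrite !linear0.
  - move=> a _ _ _ _ [x [-> ->]] [y [-> ->]].
    by exists (a *: x + y); rewrite !linearP.
  - by move=> _ [a [/esym + ->]]; rewrite -(linear0 i) => /iI ->; rewrite linear0.
by exists g => x; apply: gP; exists x.
Qed.
End Graphs.

(** * Self-injective local artinian rings *)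

Section Product.
Variables (R : comPzRingType) (I : Type) (M : I -> lmodType R).

Definition product := forall i, M i.
HB.instance Definition _ := gen_eqMixin product.
HB.instance Definition _ := gen_choiceMixin product.

Implicit Types f g h : product.
Definition product_add f g : product := fun i => f i + g i.
Definition product_opp f : product := fun i => - f i.
Definition product_zero : product := fun=> 0.
Definition product_scale (a : R) f : product := fun i => a *: f i.

Let ext f g : (forall i, f i = g i) -> f = g.
Proof. exact: functional_extensionality_dep. Qed.

Lemma product_addA : associative product_add.
Proof. by move=> f g h; apply: ext => i; apply: addrA. Qed.
Lemma product_addC : commutative product_add.
Proof. by move=> f g; apply: ext => i; apply: addrC. Qed.
Lemma product_add0 : left_id product_zero product_add.
Proof. by move=> f; apply: ext => i; apply: add0r. Qed.
Lemma product_addN : left_inverse product_zero product_opp product_add.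
Proof. by move=> f; apply: ext => i; apply: addNr. Qed.
HB.instance Definition _ := GRing.isZmodule.Build product
  product_addA product_addC product_add0 product_addN.

Lemma product_scaleA a c f :
  product_scale a (product_scale c f) = product_scale (a * c) f.
Proof. by apply: ext => i; apply: scalerA. Qed.
Lemma product_scale1 : left_id 1 product_scale.
Proof. by move=> f; apply: ext => i; apply: scale1r. Qed.
Lemma product_scaleDr : right_distributive product_scale +%R.
Proof. by move=> a f g; apply: ext => i; apply: scalerDr. Qed.
Lemma product_scaleDl f : {morph product_scale^~ f : a c / a + c}.
Proof. by move=> a c; apply: ext => i; apply: scalerDl. Qed.
HB.instance Definition _ := GRing.Zmodule_isLmodule.Build R product
  product_scaleA product_scale1 product_scaleDr product_scaleDl.

Lemma product_ideal_injective :
  (forall i, ideal_injective (M i)) -> ideal_injective product.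
Proof.
move=> Minj G GL.
have H i : exists e, forall c z, G c z -> z i = (c : R) *: e.
  have [|e eP] := Minj i (fun c y => exists z, G c z /\ y = z i).
    split.
    - by exists 0; split=> //; apply: graph0.
    - move=> a c _ c' _ [z [Gz ->]] [z' [Gz' ->]].
      by exists (a *: z + z'); split=> //; apply: graphD => //; apply: graphZ.
    - by move=> _ [z [Gz ->]]; rewrite (graph_fun GL Gz (graph0 GL)).
  by exists e => c z Gz; apply: eP; exists z.
exists (fun i => projT1 (cid (H i))) => c z Gz; apply: ext => i.
by have := projT2 (cid (H i)); apply.
Qed.
End Product.

(** * Local rings with nilpotent maximal ideal *)

Section LocalArtinian.
Variables (A : comPzRingType) (m : A -> Prop).

Record local_artinian : Prop := LocalArtinian {
  maxid_submodule : submodule (m : A^o -> Prop);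
  maxid1 : ~ m 1;
  maxid_unit : forall a, ~ m a -> exists b, b * a = 1;
  maxid_nilpotent : exists N, forall s : seq A,
    size s = N -> (forall x, x \in s -> m x) -> \prod_(x <- s) x = 0;
  maxid_fg : exists s : seq A^o, forall a, m a <-> Defs.span s a
}.
Hypothesis Aloc : local_artinian.
Implicit Types M E : lmodType A.

(** If every multiple of [x] outside [D] could be moved outside [D] again by an element of [m], a
    product of [N] elements of [m], which is zero, would carry [x] outside [D]. So some multiple of
    [x] is a nonzero socle element modulo [D]. *)
Lemma escape_maxid M (D : M -> Prop) x : submodule D -> ~ D x ->
  exists b, ~ D (b *: x) /\ forall a, m a -> D (a *: (b *: x)).
Proof.
move=> DS nDx; apply: contrapT => nb.
have H b : ~ D (b *: x) -> exists2 a, m a & ~ D (a *: (b *: x)).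
  move=> nDb; apply: contrapT => na; apply: nb; exists b; split=> // a ma.
  by apply: contrapT => nDab; apply: na; exists a.
have [N Nnil] := maxid_nilpotent Aloc.
have {H} [s [sN sm]] : exists s : seq A, [/\ size s = N,
    forall y, y \in s -> m y & ~ D ((\prod_(y <- s) y) *: x)].
  elim: N {Nnil} => [|N [s [sN sm sD]]].
    by exists [::]; rewrite big_nil scale1r.
  have [a ma naD] := H _ sD; exists (a :: s); split=> /=.
  - by rewrite sN.
  - by move=> y; rewrite inE => /predU1P[-> //|/sm].
  - by rewrite big_cons -scalerA.
by rewrite Nnil // scale0r => /(_ (submod0 DS)).
Qed.

Lemma one_neq0 : 1 <> 0 :> A.
Proof.
by move=> e; apply: (maxid1 Aloc); rewrite e; apply: submod0 (maxid_submodule Aloc).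
Qed.

Definition maxid_multiple M (x : M) : Prop :=
  exists n (a : 'I_n -> A) (z : 'I_n -> M),
    (forall i, m (a i)) /\ x = \sum_i a i *: z i.

(** Nilpotency of [m] takes the place of finite generation of [M]: substituting [M = D + m M] into
    itself [N] times leaves only [D]. *)
Lemma nakayama M (D : M -> Prop) : submodule D ->
  (forall x, exists2 d, D d & maxid_multiple (x - d)) -> forall x, D x.
Proof.
move=> DS Dgen.
have [N Nnil] := maxid_nilpotent Aloc.
suff H k : (k <= N)%N -> forall s : seq A, size s = (N - k)%N ->
    (forall y, y \in s -> m y) -> forall x, D ((\prod_(y <- s) y) *: x).
  move=> x; have := H N (leqnn N) [::]; rewrite subnn.
  by move=> /(_ erefl) H0; rewrite -[x]scale1r -(big_nil 1 *%R predT id); apply: H0.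
elim: k => [|k IHk] kN s sN sm x.
  by rewrite Nnil ?scale0r //; [apply: submod0 | rewrite sN subn0].
have [d Dd [n [a [z [ma xd]]]]] := Dgen x.
rewrite -(subrK d x) xd scalerDr scaler_sumr.
apply: submodD; [by [] | | exact: submodZ].
apply: submod_sum => // i; rewrite scalerA mulrC.
have := IHk (ltnW kN) (a i :: s); rewrite big_cons; apply.
  by rewrite /= sN -subSn.
by move=> y; rewrite inE => /predU1P[->|/sm//].
Qed.

(** Amounts to the vanishing of [Ext^1(A/m, E)]. The domain of the graph may exceed [m], but only
    the values on [m] are matched. *)
Definition residue_injective E : Prop :=
  forall G : A^o -> E -> Prop, partial_linear G ->
    (forall a, m a -> exists z, G a z) ->
    exists e, forall a z, m a -> G a z -> z = a *: e.

(** If [1] is outside the domain of a maximal extension, some [b] outside it has [m b] inside. The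
    map sending [c] to the value at [c b] then agrees on [m] with multiplication by some [e], and
    [(b, e)] can be adjoined, since a unit multiple of [b] cannot be in the domain. *)
Lemma residue_ideal_injective E : residue_injective E -> ideal_injective E.
Proof.
move=> Einj G GL; have [G' [GL' GG' Gmax]] := graph_maximal GL.
have [[e Ge]|n1] := pselect (exists e, G' 1 e).
  exists e => c z /GG' Gz; apply: (graph_fun GL' Gz).
  by have := graphZ GL' c Ge; rewrite [X in G' X]mulr1.
have [b [nb mb]] := escape_maxid (submodule_dom GL') n1.
have b1 : b *: (1 : A^o) = b by apply: mulr1.
rewrite b1 in nb mb.
have [|a /mb//|e eP] := Einj (fun c z => G' ((c : A) *: (b : A^o)) z).
  split=> [|a c z c' z' Hz Hz'|z]; rewrite ?scale0r; first exact: graph0.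
    by rewrite scalerDl -scalerA; apply: graphD => //; apply: graphZ.
  by case: GL' => _ _; apply.
case: (nb); exists e; apply: Gmax => c z Gz.
have [/eP|nmc] := pselect (m c); first exact.
have [c' c'c] := maxid_unit Aloc nmc.
case: nb; exists (c' *: z); have := graphZ GL' c' Gz.
by rewrite [c' *: (c *: _)]scalerA c'c scale1r.
Qed.

Lemma exists_socle : exists s : A, s <> 0 /\ forall a, m a -> a * s = 0.
Proof.
have [||b [nb mb]] := @escape_maxid A^o (fun x => x = 0) (1 : A).
- by split=> // a x y -> ->; rewrite scaler0 addr0.
- exact: one_neq0.
rewrite [_ *: _]mulr1 in nb mb.
by exists b; split=> // a /mb; rewrite [_ *: _]mulr1.
Qed.

(** * Socle elements: injective dimension, cogeneration and lifting *)

Section Socle.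
Variables (sigma : A) (sigma0 : sigma <> 0).
Hypothesis sigmaP : forall a, m a -> a * sigma = 0.

Lemma socle_coef a : a * sigma = 0 -> m a.
Proof.
move=> a0; apply: contrapT => /(maxid_unit Aloc)[b ba]; apply: sigma0.
by rewrite -[sigma]mul1r -ba -mulrA a0 mulr0.
Qed.

(** Sending [c * sigma] to [c *: z] is well defined because [m], the annihilator of [sigma], kills
    [z]; Baer's condition applies to the ideal generated by [sigma]. *)
Lemma ideal_injective_socle E z : ideal_injective E ->
  (forall a, m a -> a *: z = 0) -> exists e : E, z = sigma *: e.
Proof.
move=> Einj mz.
have [|e eP] := Einj (fun a y => exists c, a = c * sigma /\ y = c *: z).
  split.
  - by exists 0; rewrite mul0r scale0r.
  - move=> a _ _ _ _ [c [-> ->]] [c' [-> ->]].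
    exists (a * c + c'); split; last by rewrite scalerDl scalerA.
    by rewrite mulrDl -mulrA.
  - by move=> _ [c [/esym/socle_coef/mz ? ->]].
by exists e; apply: eP; exists 1; rewrite mul1r scale1r.
Qed.

(** The conclusion of [ideal_injective_socle] for the image of [d], with the cofactor of [sigma]
    taken in that image. *)
Definition socle_liftable (I I' : lmodType A) (d : {linear I -> I'}) : Prop :=
  forall e, (forall a, m a -> a *: d e = 0) -> exists e', d e = sigma *: d e'.

(** Viewed in [I], a map from [m] to [Z] is multiplication by some [e], and [d e] is killed by [m].
    Subtracting [sigma *: e'] brings [e] into [Z] and changes nothing on [m], because [m] kills
    [sigma]. *)
Lemma syzygy_residue_injective (Z I I' : lmodType A)
    (u : {linear Z -> I}) (d : {linear I -> I'}) :
  injective u -> ideal_injective I -> exact u d -> socle_liftable d ->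
  residue_injective Z.
Proof.
move=> u_inj Iinj ud dlift G GL mG.
have [|e eP] := Iinj (fun c y => exists2 z, G c z & y = u z).
  split.
  - by exists 0; rewrite ?linear0 //; apply: graph0.
  - move=> a c _ c' _ [z Gz ->] [z' Gz' ->].
    exists (a *: z + z'); last by rewrite linearP.
    by apply: graphD => //; apply: graphZ.
  - by move=> _ [z Gz ->]; rewrite (graph_fun GL Gz (graph0 GL)) linear0.
have [a ma|e' e'P] := dlift e.
  have [z Gz] := mG _ ma; rewrite -linearZ /= -(eP a (u z)); last by exists z.
  by apply/(ud (u z)).2; exists z.
have /(ud _).1[w uw] : d (e - sigma *: e') = 0.
  by rewrite linearB linearZ /= e'P subrr.
exists w => a z ma Gz; apply: u_inj; rewrite linearZ /= uw scalerBr scalerA.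
by rewrite sigmaP // scale0r subr0; apply: eP; exists z.
Qed.

(** Descending induction: from degree [n] on, the differential lands in zero. If the differential of
    degree [k.+1] is socle liftable, its kernel is injective; this kernel is the image of the
    differential of degree [k], which is therefore socle liftable too. *)
Lemma finite_injdim_residue_injective M :
  finite_injdim M -> residue_injective M.
Proof.
move=> [I [n In0]].
have Iinj k : ideal_injective (res_obj I k).
  exact/injective_moduleP/res_injective.
suff lift k : socle_liftable (res_diff I k).
  exact: (syzygy_residue_injective (@res_aug_inj _ _ I) (Iinj 0) (@res_exact0 _ _ I)).
have [j] := ubnP (n - k)%N; elim: j k => // j IHj k nkj.
have [nk|kn] := leqP n k.
  by move=> e _; exists 0; rewrite linear0 scaler0; apply: In0.
have lift : socle_liftable (res_diff I k.+1) by apply: IHj; rewrite subnSK.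
pose kerS := submodule_ker (res_diff I k.+1).
pose u : {linear submodule_type kerS -> res_obj I k.+1} := val.
have Zinj : ideal_injective (submodule_type kerS).
  apply: residue_ideal_injective.
  apply: (syzygy_residue_injective (u := u) _ (Iinj k.+1) _ lift).
    exact: val_inj.
  move=> y; split=> [dy|[x <-]]; last exact: (submodule_typeP x).
  by exists (submodule_sub kerS dy).
move=> e me; have de : res_diff I k.+1 (res_diff I k e) = 0.
  by apply/(@res_exact _ _ I k _).2; exists e.
have [a /me ea|z zP] := ideal_injective_socle (z := submodule_sub kerS de) Zinj.
  exact: val_inj.
have /res_exact[e' e'P] := submodule_typeP z.
by exists e'; rewrite e'P; apply: (congr1 u zP).
Qed.

(** With [b *: x] a nonzero socle element modulo [D], sending [d + c *: (b *: x)] to [c * sigma] is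
    well defined and extends to [M] by self-injectivity. *)
Lemma cogenerator M (D : M -> Prop) x : ideal_injective A^o ->
  submodule D -> ~ D x ->
  exists phi : {linear M -> A^o}, (forall d, D d -> phi d = 0) /\ phi x <> 0.
Proof.
move=> Ainj DS nDx; have [b [nDb mDb]] := escape_maxid DS nDx.
have [|phi phiP] := @ideal_injective_extend _ A^o M
    (fun y z => exists c d, [/\ D d, y = d + c *: (b *: x) & z = c * sigma]) Ainj.
  split.
  - by exists 0, 0; rewrite scale0r mul0r addr0; split=> //; apply: submod0.
  - move=> a _ _ _ _ [c [d [Dd -> ->]]] [c' [d' [Dd' -> ->]]].
    exists (a * c + c'), (a *: d + d'); split.
    + by apply: submodD => //; apply: submodZ.
    + by rewrite scalerDr [in RHS]scalerDl [a *: (c *: _)]scalerA addrACA.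
    + by rewrite mulrDl -mulrA.
  - move=> _ [c [d [Dd d0 ->]]]; apply: contrapT => nc; apply: nDb.
    have [/sigmaP//|/(maxid_unit Aloc)[c' c'c]] := pselect (m c).
    rewrite -[b *: x]scale1r -c'c -scalerA; apply: submodZ => //.
    by rewrite -(addKr d (c *: _)) -d0 addr0; apply: submodN.
exists phi; split=> [d Dd|phi0].
  by apply: phiP; exists 0, d; rewrite scale0r mul0r addr0.
apply: sigma0; rewrite -(phiP (b *: x) sigma); first by rewrite linearZ /= phi0 scaler0.
by exists 1, 0; rewrite scale1r add0r mul1r; split=> //; apply: submod0.
Qed.

(** Elements killed by the socle of [A] lie in [m M]. Free modules have this property when the socle
    contains [sigma], whose annihilator is [m], and [m] is finitely generated. *)
Definition socle_divisible M : Prop := forall x : M,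
  (forall c, (forall a, m a -> a * c = 0) -> c *: x = 0) -> maxid_multiple x.

(* Being closed under division by the socle makes the domain of a maximal
   partial lift behave like a free submodule. *)
Lemma socle_divisible_lift (J E N : lmodType A)
    (d : {linear E -> N}) (h : {linear J -> N}) :
  ideal_injective A^o -> socle_divisible J ->
  (forall x, exists e, d e = h x) ->
  exists k : {linear J -> E}, forall x, d (k x) = h x.
Proof.
move=> Ainj Jdiv dh.
(* Self-injectivity makes the socle the ideal generated by [sigma]. *)
have socE c : (forall a, m a -> a * c = 0) -> exists c', c = c' * sigma.
  move=> mc; have [c' cE] := @ideal_injective_socle A^o c Ainj mc.
  by exists c'; rewrite mulrC; exact: cE.
pose Phi (G : J -> E -> Prop) := [/\ partial_linear G,
  forall x e, G x e -> d e = h x &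
  forall x e, G x e -> (forall a, m a -> a *: x = 0) ->
    exists y f, G y f /\ x = sigma *: y].
have [|||G [[GL Gd Gs] _ Gmax]] := @graph_zorn J E Phi (fun x e => x = 0 /\ e = 0).
- split=> [|_ _ [-> ->]|_ _ [-> _] _]; rewrite ?linear0 //; last first.
    by exists 0, 0; rewrite scaler0.
  by split=> [//|a _ _ _ _ [-> ->] [-> ->]|e [_ ->]]; rewrite ?scaler0 ?addr0.
- by exists 0, 0.
- move=> F Fn FPhi Ftot; split.
  + by apply: partial_linear_chain => // X /FPhi[].
  + by move=> x e [X /FPhi[_ Xd _]]; apply: Xd.
  + move=> x e [X FX Xxe] mx; have [_ _ Xs] := FPhi _ FX.
    by have [y [f [Xyf ->]]] := Xs _ _ Xxe mx; exists y, f; split=> //; exists X.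
suff Gtot x : exists e, G x e.
  by have [k kP] := graph_map GL Gtot; exists k => x; apply: Gd.
move: x; apply: nakayama (submodule_dom GL) _ => x.
apply: contrapT => nx.
have {nx} nx y e : G y e -> ~ maxid_multiple (x - y).
  by move=> Gye mxy; apply: nx; exists y => //; exists e.
(* If [c] is nonzero, some multiple of it is a unit times [sigma], so [sigma *: x] is in the domain
   and equals [sigma *: y] with [y] in the domain; then [x - y] is killed by the socle, hence lies
   in [m J], against the choice of [x]. *)
have free c e : G (c *: x) e -> c = 0.
  move=> Gc; apply: contrapT => c0.
  have [||b [nb mb]] := @escape_maxid A^o (fun y => y = 0) (c : A).
  - by split=> // a y z -> ->; rewrite scaler0 addr0.
  - by [].
  have [|v vE] := socE (b * c); first by move=> a /mb.
  have [v' v'v] : exists v', v' * v = 1.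
    by apply: (maxid_unit Aloc) => /sigmaP v0; apply: nb; rewrite -v0 -vE.
  have Gs1 : G (sigma *: x) ((v' * b) *: e).
    have := graphZ GL (v' * b) Gc.
    by rewrite scalerA -mulrA vE mulrA v'v mul1r.
  have [a ma|y [f [Gy sy]]] := Gs _ _ Gs1; first by rewrite scalerA sigmaP ?scale0r.
  apply: (nx _ _ Gy); apply: Jdiv => u /socE[u' ->].
  by rewrite -scalerA scalerBr sy subrr scaler0.
have [e eP] := dh x.
(* As [x - x = 0] lies in [m J], a contradiction follows once [x] is put into the domain; by [free],
   any preimage [e] of [h x] may be its value. *)
apply: (nx x e); last first.
  by exists 0, (fun=> 0), (fun=> 0); split=> [[]//|]; rewrite big_ord0 subrr.
apply: (Gmax (adjoin G x e)); [|by move=> *; apply: adjoinW|exact: adjoin_mem].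
split.
- apply: adjoin_partial_linear => // c z Gc; have c0 := free _ _ Gc.
  by move: Gc; rewrite c0 !scale0r => Gz; apply: (graph_fun GL Gz); apply: graph0.
- move=> _ _ [c [y [f [Gyf -> ->]]]].
  by rewrite !linearD !linearZ /= eP (Gd _ _ Gyf).
- move=> _ _ [c [y [f [Gyf -> _]]]] mw.
  (* If [m] kills [y + c *: x], then [m] kills [c] by [free], so [c] is a multiple of [sigma], and
     consequently [m] kills [y] as well. *)
  have [a ma|c' c'E] := socE c.
    apply: (free _ (- (a *: f))); have /eqP := mw a ma.
    rewrite scalerDr addrC addr_eq0 scalerA => /eqP ->.
    by rewrite -!scaleN1r; apply: graphZ => //; apply: graphZ.
  have [a ma|y' [f' [Gy' yE]]] := Gs _ _ Gyf.
    move: (mw a ma); rewrite c'E scalerDr [a *: (_ *: x)]scalerA mulrCA sigmaP //.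
    by rewrite mulr0 scale0r addr0.
  exists (y' + c' *: x), (f' + c' *: e); split.
    by exists c', y', f'.
  by rewrite yE c'E scalerDr scalerA mulrC.
Qed.
End Socle.

(** * Free modules *)

Section FiniteSupport.
Variable X : choiceType.

Definition finite_support (g : product (fun _ : X => A^o)) : Prop :=
  exists s : seq X, forall x, x \notin s -> g x = 0.

Lemma finite_support_submodule : submodule finite_support.
Proof.
split=> [|a f g [s fs] [t gt]]; first by exists [::].
exists (s ++ t) => x; rewrite mem_cat negb_or => /andP[/fs fx /gt gx].
rewrite -[LHS]/(a *: f x + g x) fx gx.
by rewrite scaler0 addr0.
Qed.

Definition free_module := submodule_type finite_support_submodule.

(** The values on finitely many generators of [m] are supported in one finite list [s]; a multiplier
    found in the full product can be cut off outside [s]. *)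
Lemma free_module_ideal_injective :
  ideal_injective A^o -> ideal_injective free_module.
Proof.
move=> Ainj; apply: residue_ideal_injective => G GL mG.
have [gens gensP] := maxid_fg Aloc.
have gensm i : m (nth 0 gens i).
  have [ig|/(nth_default _)->] := ltnP i (size gens); last first.
    exact: submod0 (maxid_submodule Aloc).
  apply/gensP; exists (fun j => (j == Ordinal ig)%:R).
  rewrite (bigD1 (Ordinal ig)) //= eqxx scale1r big1 ?addr0 // => j /negPf ->.
  by rewrite scale0r.
have [z zP] := choice (fun i : nat => mG _ (gensm i)).
have [t tP] := choice (fun i : nat => submodule_typeP (z i)).
pose s := flatten [seq t i | i <- iota 0 (size gens)].
have supp a y x : m a -> G a y -> x \notin s -> val y x = 0.
  move=> /gensP[c ->] Gy xs.
  have Gz : G (\sum_(i < size gens) c i *: gens`_i) (\sum_(i < size gens) c i *: z i).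
    elim/big_rec2: _ => [|i b b' _ Gb]; first exact: graph0.
    by apply: graphD => //; apply: graphZ.
  rewrite (graph_fun GL Gy Gz) linear_sum /=.
  elim/big_rec: _ => // i g _ g0; rewrite -[LHS]/(c i *: val (z i) x + g x) g0 addr0.
  rewrite tP ?scaler0 //; apply: contra xs => xt; apply/flattenP.
  by exists (t i) => //; apply: map_f; rewrite mem_iota /=.
have Pinj := product_ideal_injective (fun _ : X => Ainj).
have [|e eP] := Pinj (fun a y => exists2 y', G a y' & y = val y').
  split.
  - by exists 0 => //; apply: graph0.
  - move=> a b _ b' _ [y Gy ->] [y' Gy' ->].
    by exists (a *: y + y') => //; apply: graphD => //; apply: graphZ.
  - by move=> _ [y Gy ->]; rewrite (graph_fun GL Gy (graph0 GL)).
pose e' : product (fun _ : X => A^o) := fun x => if x \in s then e x else 0.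
have e'S : finite_support e' by exists s => x /negPf xs; rewrite /e' xs.
exists (submodule_sub finite_support_submodule e'S) => a y ma Gy.
apply: val_inj; apply: functional_extensionality_dep => x.
have := congr1 (@^~ x) (eP a (val y) (ex_intro2 _ _ y Gy erefl)) => /= yx.
rewrite -[RHS]/(a *: e' x) /e'; case: ifPn => [//|xs].
by rewrite scaler0 (supp a).
Qed.

Variables (M : lmodType A) (phi : X -> M).

(** The chosen support list may have repeated entries, hence [undup]; [eval_freeE] removes the
    dependence on the choice. *)
Definition eval_free (g : free_module) : M :=
  \sum_(x <- undup (projT1 (cid (submodule_typeP g)))) val g x *: phi x.

Lemma eval_freeE (g : free_module) (s : seq X) :
  uniq s -> (forall x, x \notin s -> val g x = 0) ->
  eval_free g = \sum_(x <- s) val g x *: phi x.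
Proof.
have supp (t : seq X) : \sum_(x <- t) val g x *: phi x =
    \sum_(x <- [seq x <- t | val g x != 0]) val g x *: phi x.
  rewrite big_filter [RHS]big_mkcond; apply: eq_bigr => x _.
  by case: eqP => //= ->; rewrite scale0r.
move=> us gs; rewrite /eval_free; case: cid => /= t gt.
rewrite supp [RHS]supp; apply: perm_big; apply: uniq_perm.
- by rewrite filter_uniq ?undup_uniq.
- by rewrite filter_uniq.
move=> x; rewrite !mem_filter mem_undup.
apply: andb_id2l => gx.
have -> : x \in s by apply: contraNT gx => /gs/eqP.
by apply: contraNT gx => /gt/eqP.
Qed.

Lemma eval_free_linear : linear eval_free.
Proof.
move=> a f g; have [s fs] := submodule_typeP f; have [t gt] := submodule_typeP g.
have us := undup_uniq (s ++ t).
have H (h : free_module) : (forall x, x \notin s ++ t -> val h x = 0) ->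
    eval_free h = \sum_(x <- undup (s ++ t)) val h x *: phi x.
  by move=> hst; apply: eval_freeE => // x; rewrite mem_undup => /hst.
have fst x : x \notin s ++ t -> val f x = 0.
  by rewrite mem_cat negb_or => /andP[/fs].
have gst x : x \notin s ++ t -> val g x = 0.
  by rewrite mem_cat negb_or => /andP[_ /gt].
rewrite !H // => [|x xst].
  rewrite scaler_sumr -big_split /=; apply: eq_bigr => x _.
  by rewrite scalerA -scalerDl.
by rewrite -[LHS]/(a *: val f x + val g x) fst // gst // scaler0 addr0.
Qed.

Lemma eval_free_sub (D : M -> Prop) g :
  submodule D -> (forall x, D (phi x)) -> D (eval_free g).
Proof. by move=> DS Dphi; apply: submod_sum => // x; apply: submodZ. Qed.

Lemma eval_free_onto x : exists g, eval_free g = phi x.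
Proof.
pose g : product (fun _ : X => A^o) := fun y => (y == x)%:R.
have gS : finite_support g by exists [:: x] => y; rewrite inE /g => /negPf ->.
exists (submodule_sub finite_support_submodule gS).
rewrite (eval_freeE (s := [:: x])) // => [|y]; last by rewrite inE /= /g => /negPf ->.
by rewrite big_seq1 /= /g eqxx scale1r.
Qed.
End FiniteSupport.

(** * Resolutions by free modules and by products of copies of the ring *)

Section Coresolution.
Variables (N : lmodType A) (D : N -> Prop).

(** These are the functionals on [N / D]; they separate its points when [A] is self-injective. *)
Definition functional := {phi : {linear N -> A^o} | forall x, D x -> phi x = 0}.
Definition cogenerated := product (fun _ : functional => A^o).
Definition to_cogenerated (x : N) : cogenerated := fun phi => sval phi x.

Lemma to_cogenerated_linear : linear to_cogenerated.
Proof.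
move=> a x y; apply: functional_extensionality_dep => phi.
by rewrite /to_cogenerated linearP.
Qed.

Lemma to_cogenerated_eq0 x : ideal_injective A^o -> submodule D ->
  to_cogenerated x = 0 <-> D x.
Proof.
move=> Ainj DS; have [sigma [s0 sP]] := exists_socle.
split=> [x0|Dx]; last first.
  by apply: functional_extensionality_dep => -[phi phiD]; apply: phiD.
apply: contrapT => nDx; have [phi [phiD]] := cogenerator s0 sP Ainj DS nDx.
by apply; apply: (congr1 (@^~ (exist _ phi phiD : functional)) x0).
Qed.
End Coresolution.

(** Bundling a map with its two ends lets resolutions be produced by [iter]. *)
Record arrow := Arrow {
  source : lmodType A;
  target : lmodType A;
  arrow_map :> {linear source -> target}
}.

Definition next_arrow (f : arrow) : arrow :=
  Arrow (linear_of (@to_cogenerated_linear (target f)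
    (fun y => exists x, f x = y))).

(** The free module on the underlying set of the kernel of [f], mapped onto that kernel. *)
Definition prev_arrow (f : arrow) : arrow :=
  Arrow (linear_of (eval_free_linear
    (val : submodule_type (submodule_ker f) -> source f))).

Lemma next_arrow_exact (f : arrow) : ideal_injective A^o -> exact f (next_arrow f).
Proof. by move=> Ainj y; apply: to_cogenerated_eq0 => //; apply: submodule_im. Qed.

Lemma prev_arrow_exact (f : arrow) : exact (prev_arrow f) f.
Proof.
move=> y; split=> [fy|[g <-]].
  exact: (eval_free_onto _ (submodule_sub (submodule_ker f) fy)).
apply: (eval_free_sub (phi := val) g (submodule_ker f)).
exact: submodule_typeP.
Qed.

Lemma left_resolution (M : lmodType A) : ideal_injective A^o ->
  exists (N : nat -> lmodType A) (d : forall n, {linear N n.+1 -> N n})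
    (e : {linear N 0 -> M}),
  [/\ forall x, exists y, e y = x, exact (d 0) e, forall n, exact (d n.+1) (d n) &
      forall n, ideal_injective (N n)].
Proof.
move=> Ainj; pose f0 := Arrow (linear_of (eval_free_linear (@id M))).
pose f n := iter n prev_arrow f0.
exists (fun n => source (f n)), (fun n => f n.+1), f0; split.
- exact: eval_free_onto.
- exact: (@prev_arrow_exact f0).
- by move=> n; exact: (@prev_arrow_exact (f n.+1)).
- by move=> [|n]; apply: free_module_ideal_injective.
Qed.

Lemma right_resolution (M : lmodType A) : ideal_injective A^o ->
  exists (P : nat -> lmodType A) (d : forall n, {linear P n -> P n.+1})
    (u : {linear M -> P 0}),
  [/\ injective u, exact u (d 0), forall n, exact (d n) (d n.+1) &
      forall n, ideal_injective (P n)].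
Proof.
move=> Ainj.
pose f0 := Arrow (linear_of (@to_cogenerated_linear M (fun x => x = 0))).
pose f n := iter n next_arrow f0.
exists (fun n => target (f n)), (fun n => f n.+1), f0; split.
- have S0 : submodule (fun x : M => x = 0).
    by split=> // a z t -> ->; rewrite scaler0 addr0.
  move=> x y e; apply/subr0_eq/(to_cogenerated_eq0 (x - y) Ainj S0).
  by rewrite -[LHS]/(f0 (x - y)) linearB e subrr.
- exact: (@next_arrow_exact f0 Ainj).
- by move=> n; exact: (@next_arrow_exact (f n.+1) Ainj).
- by move=> [|n]; apply: product_ideal_injective.
Qed.
End LocalArtinian.

(** * Gorenstein injective modules *)

Section Restriction.
Variables (R A : comPzRingType) (iota : {rmorphism R -> A}).

Definition restrict of {rmorphism R -> A} := fun M : lmodType A => M : Type.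
Local Notation restr := (restrict iota).

Section Module.
Variable M : lmodType A.
HB.instance Definition _ := GRing.Zmodule.on (restr M).

Definition restrict_scale (r : R) (x : restr M) : restr M :=
  iota r *: (x : M).

Lemma restrict_scaleA a c x :
  restrict_scale a (restrict_scale c x) = restrict_scale (a * c) x.
Proof. by rewrite /restrict_scale scalerA rmorphM. Qed.
Lemma restrict_scale1 : left_id 1 restrict_scale.
Proof. by move=> x; rewrite /restrict_scale rmorph1 scale1r. Qed.
Lemma restrict_scaleDr : right_distributive restrict_scale +%R.
Proof. by move=> a x y; rewrite /restrict_scale scalerDr. Qed.
Lemma restrict_scaleDl x : {morph restrict_scale^~ x : a c / a + c}.
Proof. by move=> a c; rewrite /restrict_scale rmorphD scalerDl. Qed.
HB.instance Definition _ := GRing.Zmodule_isLmodule.Build R (restr M)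
  restrict_scaleA restrict_scale1 restrict_scaleDr restrict_scaleDl.
End Module.

Lemma restrict_linear (M N : lmodType A) (f : {linear M -> N}) :
  linear (f : restr M -> restr N).
Proof. by move=> a x y; apply: linearP. Qed.

Definition restrict_map (M N : lmodType A) (f : {linear M -> N}) :
  {linear restr M -> restr N} := linear_of (restrict_linear f).
End Restriction.

Section Gorenstein.
Variable R : comPzRingType.
Implicit Types G M N I : lmodType R.

(** In an exact complex this expresses exactness of [Hom(I, -)] one map at a time, so the pieces of
    a spliced complex can be treated separately. *)
Definition injective_lift M N (f : {linear M -> N}) : Prop :=
  forall I (h : {linear I -> N}), injective_module I ->
    (forall x, exists y, f y = h x) ->
    exists k : {linear I -> M}, forall x, f (k x) = h x.

Lemma injective_lift_hom_exact I M N (K : lmodType R)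
    (f : {linear M -> N}) (g : {linear N -> K}) :
  exact f g -> injective_lift f -> injective_module I -> hom_exact I f g.
Proof.
move=> fg flift Iinj h; split=> [gh|[k kP] x]; last first.
  by apply/(fg (h x)).2; exists (k x).
by apply: flift => // x; apply/(fg (h x)).1.
Qed.

(** * Splicing a left and a right resolution into a complex over the integers *)

Section Splice.
Variables (N P : nat -> lmodType R).
Variables (dN : forall n, {linear N n.+1 -> N n}) (dc : {linear N 0 -> P 0})
  (dP : forall n, {linear P n -> P n.+1}).

(** [Negz n] is [-(n+1)]: the object [N 0] has degree [-1] and [P 0] degree [0]. *)
Definition splice (i : int) : lmodType R :=
  match i with Posz n => P n | Negz n => N n end.

Lemma splice_PP n k : Posz n + 1 = Posz k -> n.+1 = k.
Proof. by rewrite -PoszD addn1 => -[]. Qed.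
Lemma splice_PN n k : Posz n + 1 = Negz k -> False.
Proof. by rewrite -PoszD. Qed.
Lemma splice_0P k : Negz 0 + 1 = Posz k -> 0%N = k.
Proof. by case. Qed.
Lemma splice_0N k : Negz 0 + 1 = Negz k -> False.
Proof. by []. Qed.
Lemma splice_NP n k : Negz n.+1 + 1 = Posz k -> False.
Proof. by []. Qed.
Lemma splice_NN n k : Negz n.+1 + 1 = Negz k -> n = k.
Proof. by case; rewrite subn1. Qed.

(** For variable [i] the degree [i + 1] does not reduce. With [j] free and a proof of [i + 1 = j],
    both degrees can be split into cases and the equation substituted away. *)
Definition splice_diff (i j : int) : i + 1 = j -> {linear splice i -> splice j} :=
  match i, j return i + 1 = j -> {linear splice i -> splice j} with
  | Posz n, Posz k => fun e =>
      eq_rect n.+1 (fun k => {linear P n -> P k}) (dP n) k (splice_PP e)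
  | Posz n, Negz k => fun e => False_rect _ (splice_PN e)
  | Negz 0, Posz k => fun e =>
      eq_rect 0 (fun k => {linear N 0 -> P k}) dc k (splice_0P e)
  | Negz 0, Negz k => fun e => False_rect _ (splice_0N e)
  | Negz n.+1, Posz k => fun e => False_rect _ (splice_NP e)
  | Negz n.+1, Negz k => fun e =>
      eq_rect n (fun k => {linear N n.+1 -> N k}) (dN n) k (splice_NN e)
  end.

Lemma splice_PPE n e : splice_diff (i := Posz n) (j := Posz n.+1) e = dP n.
Proof. by rewrite /= (eq_irrelevance (splice_PP e) erefl). Qed.
Lemma splice_0PE e : splice_diff (i := Negz 0) (j := Posz 0) e = dc.
Proof. by rewrite /= (eq_irrelevance (splice_0P e) erefl). Qed.
Lemma splice_NNE n e : splice_diff (i := Negz n.+1) (j := Negz n) e = dN n.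
Proof. by rewrite /= (eq_irrelevance (splice_NN e) erefl). Qed.

Hypotheses (dN_exact : forall n, exact (dN n.+1) (dN n))
  (dN0_exact : exact (dN 0) dc) (dP0_exact : exact dc (dP 0))
  (dP_exact : forall n, exact (dP n) (dP n.+1)).

Lemma splice_exact i j k (e : i + 1 = j) (f : j + 1 = k) :
  exact (splice_diff e) (splice_diff f).
Proof.
case: i j k e f => [n|[|n]] [k|[|k]] [l|l] e f;
  try (by have := splice_PN e); try (by have := splice_PN f);
  try (by have := splice_0N e); try (by have := splice_0N f);
  try (by have := splice_NP e); try (by have := splice_NP f).
- have kE := splice_PP e; have lE := splice_PP f; subst k l.
  by rewrite !splice_PPE; apply: dP_exact.
- have kE := splice_0P e; have lE := splice_PP f; subst k l.
  by rewrite splice_0PE splice_PPE.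
- have nE := splice_NN e; have lE := splice_0P f; subst n l.
  by rewrite splice_0PE splice_NNE.
- have nE := splice_NN e; have kE := splice_NN f; subst n k.
  by rewrite !splice_NNE; apply: dN_exact.
Qed.

Hypotheses (dN_lift : forall n, injective_lift (dN n)) (dc_lift : injective_lift dc)
  (dP_lift : forall n, injective_lift (dP n)).

Lemma splice_lift i j (e : i + 1 = j) : injective_lift (splice_diff e).
Proof.
case: i j e => [n|[|n]] [k|k] e;
  try (by have := splice_PN e); try (by have := splice_0N e);
  try (by have := splice_NP e).
- by have kE := splice_PP e; subst k; rewrite splice_PPE; apply: dP_lift.
- by have kE := splice_0P e; subst k; rewrite splice_0PE.
- by have kE := splice_NN e; subst n; rewrite splice_NNE; apply: dN_lift.
Qed.

Hypotheses (N_inj : forall n, injective_module (N n))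
  (P_inj : forall n, injective_module (P n)).

Lemma splice_gorenstein_injective G (u : {linear G -> P 0}) :
  injective u -> (forall y, (exists x, u x = y) <-> (exists x, dc x = y)) ->
  gorenstein_injective G.
Proof.
move=> u_inj u_im.
exists splice, (fun i => splice_diff (erefl (i + 1))); split.
- by case.
- by move=> i; apply: splice_exact.
- move=> I Iinj i; apply: injective_lift_hom_exact => //.
    exact: splice_exact.
  exact: splice_lift.
suff H j (e : -1 + 1 = j) : exists2 u : {linear G -> splice j}, injective u &
    forall y, (exists x, u x = y) <-> (exists x, splice_diff e x = y) by exact: H.
case: j e => [k|k] e; last by have := splice_0N e.
have kE := splice_0P e; subst k; exists u => // y.
rewrite (splice_0PE e); exact: u_im.
Qed.
End Splice.

(** * Products, isomorphisms and divisibility *)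

Lemma injective_product (I : Type) (M : I -> lmodType R) :
  (forall i, injective_module (M i)) -> injective_module (product M).
Proof.
move=> Minj; apply/injective_moduleP/product_ideal_injective => i.
exact/injective_moduleP.
Qed.

Section ProductMap.
Variables (I : Type) (M N : I -> lmodType R) (f : forall i, {linear M i -> N i}).
Definition product_fun (x : product M) : product N := fun i => f i (x i).
Lemma product_fun_linear : linear product_fun.
Proof.
by move=> a x y; apply: functional_extensionality_dep => i; apply: linearP.
Qed.
Definition product_map : {linear product M -> product N} :=
  linear_of product_fun_linear.
End ProductMap.

Section Projection.
Variables (I : Type) (M : I -> lmodType R).
Definition projection (i : I) (x : product M) : M i := x i.
Lemma projection_linear i : linear (projection i).
Proof. by []. Qed.
Variables (N : lmodType R) (f : forall i, {linear N -> M i}).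
Definition pairing (x : N) : product M := fun i => f i x.
Lemma pairing_linear : linear pairing.
Proof.
by move=> a x y; apply: functional_extensionality_dep => i; apply: linearP.
Qed.
End Projection.

Lemma gorenstein_injective_product (I : Type) (M : I -> lmodType R) :
  (forall i, gorenstein_injective (M i)) -> gorenstein_injective (product M).
Proof.
move=> MG; have /all_sig[E EP] i := cid (MG i).
have {EP} /all_sig[d dP] i := cid (EP i).
exists (fun n => product (fun i => E i n)), (fun n => product_map (fun i => d i n)).
split.
- by move=> n; apply: injective_product => i; case: (dP i) => Ei _ _ _; apply: Ei.
- move=> n y; split=> [dy|[x <-]]; last first.
    apply: functional_extensionality_dep => i; case: (dP i) => _ + _ _.
    by move=> /(_ n (d i n (x i))) -> ; exists (x i).
  have H i : exists x, d i n x = y i.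
    case: (dP i) => _ /(_ n (y i)) <- _ _.
    exact: (congr1 (@^~ i) dy).
  exists (fun i => projT1 (cid (H i))); apply: functional_extensionality_dep => i.
  exact: (projT2 (cid (H i))).
- move=> J Jinj n h; split=> [dh|[k kP] x]; last first.
    apply: functional_extensionality_dep => i; case: (dP i) => _ + _ _.
    move=> /(_ n (h x i)) dE; apply/dE; exists (k x i).
    exact: (congr1 (@^~ i) (kP x)).
  have H i : exists k : {linear J -> E i n}, forall x, d i n (k x) = h x i.
    case: (dP i) => _ _ /(_ J Jinj n (linear_of (projection_linear i) \o h)) /= -[+ _] _.
    by apply=> x; apply: (congr1 (@^~ i) (dh x)).
  have /all_sig[k kP] i := cid (H i).
  exists (linear_of (pairing_linear k)) => x.
  by apply: functional_extensionality_dep => i; apply: kP.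
- have H i : exists u : {linear M i -> E i (-1 + 1)}, injective u /\
      forall y, (exists x, u x = y) <-> (exists x, d i (-1) x = y).
    by case: (dP i) => _ _ _ [u]; exists u.
  have /all_sig[u uP] i := cid (H i).
  exists (product_map u).
    move=> x y e; apply: functional_extensionality_dep => i; apply: (uP i).1.
    exact: (congr1 (@^~ i) e).
  move=> y; split=> -[x <-].
    have H' i : exists z, d i (-1) z = u i (x i) by apply/(uP i).2; exists (x i).
    exists (fun i => projT1 (cid (H' i))); apply: functional_extensionality_dep => i.
    exact: (projT2 (cid (H' i))).
  have H' i : exists z, u i z = d i (-1) (x i) by apply/(uP i).2; exists (x i).
  exists (fun i => projT1 (cid (H' i))); apply: functional_extensionality_dep => i.
  exact: (projT2 (cid (H' i))).
Qed.

Lemma gorenstein_injective_iso G G' (f : {linear G' -> G}) :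
  injective f -> (forall y, exists x, f x = y) ->
  gorenstein_injective G -> gorenstein_injective G'.
Proof.
move=> f_inj f_onto [E [d [Einj Eex Ehom [u u_inj u_im]]]].
exists E, d; split=> //; exists (u \o f); first exact: inj_comp.
move=> y; rewrite -u_im; split=> -[x <-]; first by exists (f x).
by have [z <-] := f_onto x; exists z.
Qed.

Lemma injective_divisible (E : lmodType R) (n : nat) (y : 'I_n -> R) (x : E) :
  injective_module E -> (forall c, (forall i, c * y i = 0) -> c *: x = 0) ->
  exists z : 'I_n -> E, x = \sum_i y i *: z i.
Proof.
move=> Einj yx; pose v : {ffun 'I_n -> R^o} := [ffun i => y i].
have [|g gP] := @injective_extend _ E {ffun 'I_n -> R^o}
    (fun w z => exists c, w = c *: v /\ z = c *: x) Einj.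
  split.
  - by exists 0; rewrite !scale0r.
  - move=> a _ _ _ _ [c [-> ->]] [c' [-> ->]]; exists (a * c + c').
    by rewrite !scalerDl !scalerA.
  - move=> _ [c [/esym/ffunP cv ->]]; apply: yx => i.
    by have := cv i; rewrite !ffunE.
pose delta (i : 'I_n) : {ffun 'I_n -> R^o} := [ffun j => (i == j)%:R].
exists (fun i => g (delta i)).
rewrite -(gP v x); last by exists 1; rewrite !scale1r.
transitivity (g (\sum_i y i *: delta i)); last first.
  by rewrite linear_sum; apply: eq_bigr => i _; rewrite linearZ.
congr (g _); apply/ffunP => j; rewrite sum_ffunE (bigD1 j) //= !ffunE eqxx.
rewrite [_ *: _]mulr1 big1 ?addr0 // => i /negPf ij; rewrite !ffunE ij.
exact: scaler0.
Qed.

(** [G] is an image of the injective module [E (-1)], on which a regular element acts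
    surjectively. *)
Lemma gorenstein_injective_divisible G (s : R) (x : G) :
  (forall r, r * s = 0 -> r = 0) -> gorenstein_injective G ->
  exists y, x = s *: y.
Proof.
move=> sreg [E [d [Einj _ _ [u u_inj u_im]]]].
have [y dy] : exists y, d (-1) y = u x by apply/u_im; exists x.
have [|z yz] := injective_divisible (n := 1) (y := fun=> s) (x := y) (Einj _).
  by move=> c /(_ ord0)/sreg ->; rewrite scale0r.
have [w uw] : exists w, u w = d (-1) (z ord0) by apply/u_im; exists (z ord0).
exists w; apply: u_inj.
by rewrite linearZ /= uw -linearZ /= -dy yz big_ord1.
Qed.
End Gorenstein.

(** * Minimal primes of a noetherian ring *)

(* A copy of [prime_ideal R] in a lower universe, where it can carry an [eqType]
   structure. *)
Definition prime_set (R : comPzRingType) : Type :=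
  {p : R -> bool | is_prime (p : {pred R})}.
HB.instance Definition _ (R : comPzRingType) := gen_eqMixin (prime_set R).

Definition prime_of (R : comPzRingType) (p : prime_set R) : prime_ideal R :=
  PrimeIdeal (svalP p).
Coercion prime_of : prime_set >-> prime_ideal.

Section Noetherian.
Variable R : comPzRingType.
Implicit Types (J : R^o -> Prop) (p q : prime_ideal R).

Lemma prime_setE (p q : prime_set R) : {subset p <= q} -> {subset q <= p} -> p = q.
Proof.
case: p q => p pP [q qP] /= pq qp.
have e : p = q by apply/funext => x; apply/idP/idP => [/pq|/qp].
by subst q; rewrite (Prop_irrelevance pP qP).
Qed.

Lemma prime_submodule p : submodule (fun x : R^o => x \in p).
Proof. by have [[p0 pS] _ _] := prime_idealP p; split=> // a x y; apply: pS. Qed.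

Lemma prime_mull p a x : x \in p -> a * x \in p.
Proof. exact: (submodZ (prime_submodule p)). Qed.

Lemma prime_mulr p a x : x \in p -> x * a \in p.
Proof. by rewrite mulrC; apply: prime_mull. Qed.

Lemma prime_1 p : 1 \notin p. Proof. by have [] := prime_idealP p. Qed.

Lemma prime_mul p a b : a * b \in p -> a \in p \/ b \in p.
Proof. by have [_ _ pP] := prime_idealP p; move=> /pP/orP. Qed.

Lemma prime_exp p a n : a \notin p -> a ^+ n \notin p.
Proof.
move=> pa; elim: n => [|n IHn]; first by rewrite expr0 prime_1.
by rewrite exprS; apply/negP => /prime_mul[]; apply/negP.
Qed.

Lemma mem_span (s : seq R^o) J : submodule J ->
  (forall i, (i < size s)%N -> J s`_i) -> forall x, Defs.span s x -> J x.
Proof.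
move=> JS sJ x [c ->]; apply: submod_sum => // i; apply: submodZ => //.
exact: sJ.
Qed.

Lemma nth_span (s : seq R^o) i : (i < size s)%N -> Defs.span s s`_i.
Proof.
move=> si; exists (fun j => (j == Ordinal si)%:R).
rewrite (bigD1 (Ordinal si)) //= eqxx scale1r big1 ?addr0 // => j /negPf ->.
by rewrite scale0r.
Qed.

Hypothesis noethR : noetherian R.

Lemma noetherian_fg J : submodule J ->
  exists s : seq R^o, forall x, J x <-> Defs.span s x.
Proof.
move=> [J0 JP]; have [|s sP] := noethR (I := fun x => `[< J x >]).
  split; first exact/asboolP.
  by move=> a x y /asboolP Jx /asboolP Jy; apply/asboolP/JP.
by exists s => x; rewrite -sP; split=> /asboolP.
Qed.

(** Otherwise choice yields a strictly increasing sequence of ideals, while the finitely many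
    generators of its union lie in one term. *)
Lemma noetherian_ind (T : (R^o -> Prop) -> Prop) :
  (forall J, submodule J ->
     (forall J', submodule J' -> (forall x, J x -> J' x) ->
        (exists2 x, J' x & ~ J x) -> T J') -> T J) ->
  forall J, submodule J -> T J.
Proof.
move=> TP J JS; apply: contrapT => nTJ.
pose bad := {J : R^o -> Prop | submodule J /\ ~ T J}.
have step (K : bad) : exists K' : bad,
    (forall x, sval K x -> sval K' x) /\ exists2 x, sval K' x & ~ sval K x.
  case: K => K [KS nTK]; apply: contrapT => nK; apply: (nTK).
  apply: TP => // K' KS' KK' xK'.
  by apply: contrapT => nTK'; apply: nK; exists (exist _ K' (conj KS' nTK')).
have [f fP] := choice step.
pose C n := sval (iter n f (exist _ J (conj JS nTJ))).
have CS n : submodule (C n) by rewrite /C; case: (iter _ _ _) => K [].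
have Cmono n k x : (n <= k)%N -> C n x -> C k x.
  move=> /subnK <-; elim: (k - n)%N => // i IHi /IHi.
  by apply: (fP _).1.
have [|s sP] := @noetherian_fg (fun x => exists n, C n x).
  split=> [|a x y [i Cx] [j Cy]]; first by exists 0; apply: submod0.
  exists (maxn i j); apply: (CS _).2; first exact: Cmono (leq_maxl _ _) Cx.
  exact: Cmono (leq_maxr _ _) Cy.
have [N NP] : exists N, forall i, (i < size s)%N -> C N s`_i.
  have H i : exists n, (i < size s)%N -> C n s`_i.
    have [/nth_span/sP[n]|] := ltnP i (size s); first by exists n.
    by exists 0.
  have [g gP] := choice H.
  exists (\max_(i < size s) g i) => i si.
  exact: Cmono (leq_bigmax (Ordinal si)) (gP _ si).
have [_ [x Cx nCx]] := fP (iter N f (exist _ J (conj JS nTJ))).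
by apply: nCx; apply: (mem_span (CS N) NP); apply/sP; exists N.+1.
Qed.

(* [(J : p_1 ... p_n)] *)
Fixpoint colon (L : seq (prime_set R)) J : R^o -> Prop :=
  if L is p :: L' then colon L' (fun y => forall a, a \in p -> J (a * y)) else J.

Lemma colon_sub L J K : (forall x, J x -> K x) -> forall x, colon L J x -> colon L K x.
Proof.
elim: L J K => [|p L IHL] J K JK x /=; first exact: JK.
by apply: IHL => y Jy a pa; apply/JK/Jy.
Qed.

Lemma colon_mul L J y z : colon L (fun x => J (y * x)) z -> colon L J (y * z).
Proof.
elim: L J z => //= p L IHL J z Lz; apply: IHL.
by apply: colon_sub Lz => x Jx a pa; rewrite mulrCA; apply: Jx.
Qed.

Lemma colon_cat L1 L2 J : colon (L1 ++ L2) J = colon L2 (colon L1 J).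
Proof. by elim: L1 J => //=. Qed.

(** [colon L J 1] says that the product of the primes in [L] lies in [J]. If [J] is proper and not
    prime, it contains some [a * b] with [a], [b] outside, and the product of [J + (a)] and
    [J + (b)] lies in [J]. *)
Lemma exists_prime_product J : submodule J -> exists L, colon L J 1.
Proof.
move: J; apply: noetherian_ind => J JS IH.
have [J1|nJ1] := pselect (J 1); first by exists [::].
have [Jprime|] := pselect (forall a b, J (a * b) -> J a \/ J b).
  have PP : is_prime (fun x : R => `[< J x >]).
    split.
    - split; first exact/asboolP/(submod0 JS).
      by move=> a x y /asboolP Jx /asboolP Jy; apply/asboolP/JS.2.
    - exact/asboolP.
    - by move=> a b /asboolP/Jprime[] ?; apply/orP; [left|right]; apply/asboolP.
  by exists [:: exist _ _ PP] => /= a /asboolP Ja; rewrite mulr1.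
move=> nprime.
have [a [b [Jab nJa nJb]]] : exists a b, [/\ J (a * b), ~ J a & ~ J b].
  apply: contrapT => nab; apply: nprime => a b Jab.
  have [|nJa] := pselect (J a); first by left.
  have [|nJb] := pselect (J b); first by right.
  by case: nab; exists a, b.
pose add c (x : R^o) := exists2 y, J y & exists r, x = y + r * c.
have addS c : submodule (add c).
  split=> [|r _ _ [y Jy [u ->]] [z Jz [v ->]]].
    by exists 0; [apply: submod0 | exists 0; rewrite mul0r addr0].
  exists (r *: y + z); first exact: JS.2.
  by exists (r * u + v); rewrite scalerDr mulrDl addrACA -mulrA.
have Jadd c x : J x -> add c x by move=> Jx; exists x => //; exists 0; rewrite mul0r addr0.
have addc c : add c c by exists 0; [apply: submod0 | exists 1; rewrite mul1r add0r].
have [|L1 L1P] := IH _ (addS a) (Jadd a); first by exists a.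
have [|L2 L2P] := IH _ (addS b) (Jadd b); first by exists b.
exists (L1 ++ L2); rewrite colon_cat; apply: colon_sub L2P => _ [y Jy [r ->]].
rewrite -[_ + _]mulr1; apply: colon_mul; apply: colon_sub L1P => _ [z Jz [t ->]].
rewrite mulrDr; apply: submodD => //; first exact: (submodZ JS).
rewrite mulrDl; apply: submodD => //; first by rewrite mulrC; apply: (submodZ JS).
by rewrite mulrACA (mulrC b a); apply: (submodZ JS).
Qed.

Lemma prime_contains_factor L J p z : (forall x, J x -> x \in p) ->
  z \notin p -> colon L J z -> exists2 q : prime_set R, q \in L & {subset q <= p}.
Proof.
move=> + zp; elim: L J => [|q L IHL] J Jp /=; first by move=> /Jp; rewrite (negPf zp).
have [qp _|nqp] := pselect {subset q <= p}; first by exists q; rewrite ?mem_head.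
have [t qt pt] : exists2 t, t \in q & t \notin p.
  apply: contrapT => nt; apply: nqp => t qt; apply: contrapT => /negP pt.
  by apply: nt; exists t.
move=> /IHL[|r rL rp]; last by exists r; rewrite ?inE ?rL ?orbT.
by move=> y /(_ t qt)/Jp/prime_mul[tp|//]; rewrite tp in pt.
Qed.

Definition zero_ideal (x : R^o) : Prop := x = 0.
Lemma zero_submodule : submodule zero_ideal.
Proof. by split=> // a x y -> ->; rewrite scaler0 addr0. Qed.

(** Every prime contains a factor of a vanishing product of primes. Replacing each factor by a
    minimal prime below it keeps the product zero; repetitions in [L] serve as multiplicities. *)
Lemma exists_minimal_primes : exists L,
  [/\ colon L zero_ideal 1, forall p : prime_set R, p \in L -> minimal_prime p &
      forall p : prime_set R, minimal_prime p -> p \in L].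
Proof.
have [L0 L0P] := exists_prime_product zero_submodule.
have contains p : exists2 q : prime_set R, q \in L0 & {subset q <= p}.
  apply: prime_contains_factor (prime_1 p) L0P => x ->.
  exact: submod0 (prime_submodule p).
pose cnt p := count (fun l : prime_set R => `[< {subset l <= p} >]) L0.
have below (l : prime_set R) : l \in L0 ->
    exists2 p : prime_set R, minimal_prime p & {subset p <= l}.
  (* Induction on the number of factors contained in [l]: a factor strictly below [l] no longer
     contains [l] itself, so the number drops. *)
  have [n] := ubnP (cnt l); elim: n l => // n IHn l ln lL.
  have [lmin|] := pselect (minimal_prime l); first by exists l.
  move=> /existsNP[[q qP]] /not_implyP[ql nlq].
  pose q' : prime_set R := exist _ _ qP.
  have [l' l'L l'q] := contains q'.
  have l'l : {subset l' <= l} by move=> x /l'q/ql.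
  have [|p pmin pl'] := IHn l' _ l'L.
    rewrite ltnS in ln; apply: leq_trans ln; rewrite /cnt.
    set P := (X in count X _); set Q := (X in (_ < count X _)%N).
    rewrite -(@eq_count _ (predU P (predD Q P)) Q); last first.
      move=> r /=; case: (boolP (P r)) => //= /asboolP rl'.
      by apply/esym/asboolP => x /rl'/l'l.
    have := count_predUI P (predD Q P) L0.
    rewrite (@eq_count _ (predI P (predD Q P)) pred0); last first.
      by move=> r /=; case: (P r).
    rewrite count_pred0 addn0 => ->; rewrite -addn1 leq_add2l -has_count.
    apply/hasP; exists l => //=; apply/andP; split.
      by apply/asboolP => ll'; apply: nlq => x /ll'/l'q.
    exact/asboolP.
  by exists p => // x /pl'/l'l.
have /choice[f fP] : forall l : prime_set R, exists p : prime_set R,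
    l \in L0 -> minimal_prime p /\ {subset p <= l}.
  move=> l; have [/below[p]|nl] := pselect (l \in L0); first by exists p.
  by exists l.
pose L := [seq f l | l <- L0].
have L1 : colon L zero_ideal 1.
  rewrite /L; elim: (L0) (zero_ideal) fP L0P {contains cnt below L} => //= l s IHs J fP.
  move=> sJ; apply: IHs; first by move=> k ks; apply: fP; rewrite inE ks orbT.
  apply: colon_sub sJ => y Jy a fa; apply: Jy.
  by have [_ ->] := fP l (mem_head _ _).
exists L; split=> //.
  by move=> _ /mapP[l lL ->]; have [] := fP l lL.
move=> p pmin; have [|q qL qp] := prime_contains_factor _ (prime_1 p) L1.
  move=> x ->; exact: submod0 (prime_submodule p).
by have -> : p = q by apply: prime_setE (pmin _ qp) qp.
Qed.

(** [s] is a product with one element outside [p] from each factor other than [p]. As many elements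
    of [p] as [p] has occurrences in [L] would do; the surplus is absorbed by [J]. *)
Lemma exists_separator L J (p : prime_set R) : (forall r x, J x -> J (r * x)) ->
  (forall q : prime_set R, q \in L -> q <> p -> ~ {subset q <= p}) -> colon L J 1 ->
  exists s : R, [/\ s \notin p, forall q : prime_set R, q \in L -> q <> p -> s \in q &
    forall xs, size xs = size L -> (forall x, x \in xs -> x \in p) ->
      J (s * \prod_(x <- xs) x)].
Proof.
elim: L J => [|q L IHL] J JM Lp /=.
  move=> J1; exists 1; split=> [|//|[|//] _ _]; first exact: (prime_1 p).
  by rewrite big_nil mulr1.
have Lp' (r : prime_set R) : r \in L -> r <> p -> ~ {subset r <= p}.
  by move=> rL; apply: Lp; rewrite inE rL orbT.
have [qp|nqp] := pselect (q = p).
  subst q => LJ.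
  have [|s [sp sq sx]] := IHL _ _ Lp' LJ.
    by move=> r x Jx a pa; rewrite mulrCA; apply/JM/Jx.
  exists s; split=> // [q|[//|x xs] [xsL] xp].
    by rewrite inE => /predU1P[-> //|]; apply: sq.
  rewrite big_cons mulrCA; apply: sx => //; last exact/xp/mem_head.
  by move=> y yxs; apply: xp; rewrite inE yxs orbT.
have [t qt pt] : exists2 t, t \in (q : prime_set R) & t \notin p.
  apply: contrapT => nt; apply: (Lp q (mem_head _ _) nqp) => t qt.
  by apply: contrapT => /negP pt; apply: nt; exists t.
move=> LJ; have [||s [sp sq sx]] := IHL (fun y => J (t * y)) _ Lp'.
- by move=> r x Jx; rewrite mulrCA; apply: JM.
- by apply: colon_sub LJ => y; apply.
exists (t * s); split.
- apply/negP => ts; have [] : t \in p \/ s \in p by apply: (@prime_mul p).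
    exact/negP.
  exact/negP.
- move=> r; rewrite inE => /predU1P[-> _|rL rp].
    exact: (@prime_mulr (prime_of q)).
  by apply: (@prime_mull (prime_of r)); apply: sq.
- move=> [//|x xs] [xsL] xp; rewrite big_cons mulrCA -mulrA; apply: JM.
  by apply: sx => // y yxs; apply: xp; rewrite inE yxs orbT.
Qed.

(** The [a i] imitate orthogonal idempotents. The last clause will make the maximal ideal of the
    localization at [P i] nilpotent. *)
Record minimal_splitting n (P : 'I_n -> prime_ideal R) (a : 'I_n -> R) (N : nat) :
    Prop := MinimalSplitting {
  splitting_minimal : forall i, minimal_prime (P i);
  splitting_complete : forall p, minimal_prime p -> exists i, {subset p <= P i};
  splitting_notin : forall i, a i \notin P i;
  splitting_in : forall i j, i <> j -> a i \in P j;
  splitting_orthogonal : forall i j, i <> j -> a i * a j = 0;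
  splitting_nilpotent : forall i, exists2 s, s \notin P i &
    forall xs : seq R, size xs = N -> (forall x, x \in xs -> x \in P i) ->
      s * \prod_(x <- xs) x = 0
}.

Lemma exists_minimal_splitting :
  exists n (P : 'I_n -> prime_ideal R) a N, minimal_splitting P a N.
Proof.
have [L [L1 Lmin Lall]] := exists_minimal_primes.
pose U := undup L; pose P (i : 'I_(size U)) : prime_set R := tnth (in_tuple U) i.
have PL i : P i \in L by rewrite -mem_undup mem_tnth.
have P_inj i j : i <> j -> P i <> P j.
  by move=> ij e; apply: ij; apply: (tuple_uniqP _ _) e; apply: undup_uniq.
have sep i : exists s : R, [/\ s \notin P i,
    forall q : prime_set R, q \in L -> q <> P i -> s \in q &
    forall xs, size xs = size L -> (forall x, x \in xs -> x \in P i) ->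
      s * \prod_(x <- xs) x = 0].
  apply: (exists_separator (J := zero_ideal)) L1.
    by move=> r x ->; rewrite /zero_ideal mulr0.
  move=> q qL qP qsub; apply: qP; apply: prime_setE => //.
  exact: (Lmin _ (PL i)).
have [s sP] := choice sep.
(* [s j] lies in [P i], so its power is one of the products that [s i] kills. *)
have s0 i j : i <> j -> s i * s j ^+ size L = 0.
  move=> ij; have [_ _ /(_ (nseq (size L) (s j)))] := sP i.
  rewrite size_nseq big_nseq -Monoid.iteropE; apply=> // x /nseqP[-> _].
  by have [_ sj _] := sP j; apply: sj => //; apply: P_inj.
(* The exponent exceeds [size L] by one so that a factor [s i] can be split off to meet
   [s j ^+ size L]. *)
exists (size U), P, (fun i => s i ^+ (size L).+1), (size L); split.
- by move=> i; apply: Lmin.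
- move=> [p pP] pmin; pose q : prime_set R := exist _ _ pP.
  have : q \in U by rewrite mem_undup; apply: Lall.
  by move=> /seq_tnthP[i qi]; exists i => x; rewrite /P -qi.
- by move=> i; apply: prime_exp; have [] := sP i.
- move=> i j ij; rewrite exprS; apply: prime_mulr; have [_ si _] := sP i.
  by apply: si => // /esym; apply: P_inj.
- by move=> i j ij; rewrite exprSr exprS mulrACA s0 // mulr0.
- by move=> i; have [si _ sN] := sP i; exists (s i).
Qed.
End Noetherian.

(** * Localization at a prime *)

Section QuotientModule.
Variables (R : comPzRingType) (M : lmodType R) (P : M -> Prop) (PP : submodule P).

Definition quotient_module := Quotient.quot (submodule_pred PP).
HB.instance Definition _ := GRing.Zmodule.on quotient_module.
HB.instance Definition _ := Quotient.on quotient_module.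

Definition to_quotient (x : M) : quotient_module := \pi x.

Lemma to_quotientP x y : to_quotient x = to_quotient y <-> P (x - y).
Proof.
split=> [/eqP|Pxy].
  by rewrite -[_ == _]Quotient.idealrBE => /asboolP.
by apply/eqP; rewrite -[_ == _]Quotient.idealrBE; apply/asboolP.
Qed.

Lemma to_quotient_onto (y : quotient_module) : exists x, to_quotient x = y.
Proof. by exists (repr y); rewrite /to_quotient reprK. Qed.

Lemma to_quotientD x y : to_quotient (x + y) = to_quotient x + to_quotient y.
Proof. exact: (Quotient.pi_add (submodule_pred PP)). Qed.

Definition quotient_scale (a : R) (y : quotient_module) : quotient_module :=
  to_quotient (a *: repr y).

Lemma quotient_scaleE a x : quotient_scale a (to_quotient x) = to_quotient (a *: x).
Proof.
apply/to_quotientP; rewrite -scalerBr; apply: submodZ => //.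
by apply/to_quotientP; rewrite /to_quotient reprK.
Qed.

Lemma quotient_scaleA a c y :
  quotient_scale a (quotient_scale c y) = quotient_scale (a * c) y.
Proof. by have [x <-] := to_quotient_onto y; rewrite !quotient_scaleE scalerA. Qed.
Lemma quotient_scale1 : left_id 1 quotient_scale.
Proof.
by move=> y; have [x <-] := to_quotient_onto y; rewrite quotient_scaleE scale1r.
Qed.
Lemma quotient_scaleDr : right_distributive quotient_scale +%R.
Proof.
move=> a y y'; have [x <-] := to_quotient_onto y; have [x' <-] := to_quotient_onto y'.
by rewrite -to_quotientD !quotient_scaleE -to_quotientD scalerDr.
Qed.
Lemma quotient_scaleDl y : {morph quotient_scale^~ y : a c / a + c}.
Proof.
move=> a c; have [x <-] := to_quotient_onto y.
by rewrite !quotient_scaleE -to_quotientD scalerDl.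
Qed.
HB.instance Definition _ := GRing.Zmodule_isLmodule.Build R quotient_module
  quotient_scaleA quotient_scale1 quotient_scaleDr quotient_scaleDl.

Lemma to_quotient_linear : linear to_quotient.
Proof. by move=> a x y; rewrite to_quotientD -quotient_scaleE. Qed.
End QuotientModule.

(** * The localized ring, its primes and its depth *)

Section LocalizationRing.
Variables (R : comPzRingType) (p : prime_ideal R).
Local Notation A := (localization p).

Lemma loc_fracD (a b : R) (s t : denom p) :
  loc_frac a s + loc_frac b t = loc_frac (a * val t + b * val s) (denomM s t) :> A.
Proof. exact: loc_addE. Qed.

Lemma loc_fracM (a b : R) (s t : denom p) :
  loc_frac a s * loc_frac b t = loc_frac (a * b) (denomM s t) :> A.
Proof. exact: loc_mulE. Qed.

Lemma loc_frac_eq0 (a : R) (s : denom p) :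
  loc_frac a s = 0 <-> exists2 u, u \notin p & u * a = 0.
Proof.
split=> [/loc_fracP[u pu]|[u pu ua]].
  by rewrite /= mul0r mulr1 mulr0; exists u.
by apply/loc_fracP; exists u => //; rewrite /= mul0r mulr1 mulr0.
Qed.

Definition to_loc_fun (a : R) : A := loc_frac a (denom1 p).

Lemma to_loc_zmod : zmod_morphism to_loc_fun.
Proof.
move=> a b; rewrite -[RHS]/(loc_add _ (loc_opp _)) loc_oppE loc_addE.
by apply: loc_frac_eq => /=; ring.
Qed.

Lemma to_loc_monoid : monoid_morphism to_loc_fun.
Proof.
split=> // a b; rewrite loc_fracM; apply: loc_frac_eq => /=; ring.
Qed.

HB.instance Definition _ := GRing.isZmodMorphism.Build R A to_loc_fun to_loc_zmod.
HB.instance Definition _ := GRing.isMonoidMorphism.Build R A to_loc_fun to_loc_monoid.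
Definition to_loc : {rmorphism R -> A} := to_loc_fun.

Lemma loc_fracK (a : R) (s : denom p) : to_loc (val s) * loc_frac a s = to_loc a.
Proof.
rewrite -[LHS]/(loc_frac _ _ * _) loc_fracM; apply: loc_frac_eq => /=; ring.
Qed.

Lemma loc_unit (s : denom p) : loc_frac 1 s * to_loc (val s) = 1.
Proof. by rewrite mulrC loc_fracK rmorph1. Qed.

Lemma to_loc_eq0 (a : R) : to_loc a = 0 <-> exists2 u, u \notin p & u * a = 0.
Proof. exact: loc_frac_eq0. Qed.

Definition prime_extension (q : prime_ideal R) (x : A) : Prop :=
  exists a s, a \in q /\ x = loc_frac a s.

Lemma prime_extensionE (q : prime_ideal R) (a : R) (s : denom p) :
  {subset q <= p} -> prime_extension q (loc_frac a s) <-> a \in q.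
Proof.
move=> qp; split=> [[b [t [qb /loc_fracP[u pu e]]]]|qa]; last by exists a, s.
have qF v : v \notin p -> v \notin q by apply: contra => /qp.
have /prime_mul[qu|/prime_mul[//|qt]] : u * (a * val t) \in q.
- by rewrite e; apply/prime_mull/prime_mulr.
- by have := qF _ pu; rewrite qu.
- by have := qF _ (valP t); rewrite qt.
Qed.

Lemma prime_extension_submodule (q : prime_ideal R) :
  submodule (prime_extension q : A^o -> Prop).
Proof.
split; first by exists 0, (denom1 p); split=> //; apply: submod0 (prime_submodule q).
move=> x _ _ [a [s [qa ->]]] [b [t [qb ->]]].
elim/loc_ind: x => c u; rewrite [_ *: _]loc_fracM loc_fracD.
exists ((c * a) * val t + b * val (denomM u s)), (denomM (denomM u s) t); split=> //.
by apply: (submodD (prime_submodule q)); apply: prime_mulr => //; apply: prime_mull.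
Qed.

Lemma prime_extension_prime (q : prime_ideal R) : {subset q <= p} ->
  is_prime (fun x : A => `[< prime_extension q x >]).
Proof.
move=> qp; split.
- split; first exact/asboolP/(submod0 (prime_extension_submodule q)).
  by move=> a x y /asboolP qx /asboolP qy; apply/asboolP/(prime_extension_submodule q).2.
- apply/negP => /asboolP/(prime_extensionE _ _ qp) q1.
  by have := prime_1 q; rewrite q1.
- elim/loc_ind=> a s; elim/loc_ind=> b t /asboolP; rewrite loc_fracM.
  by move=> /(prime_extensionE _ _ qp)/prime_mul[]/(prime_extensionE _ _ qp) => H;
     apply/orP; [left|right]; apply/asboolP; apply: H.
Qed.

Lemma not_prime_extension_unit (x : A) : ~ prime_extension p x ->
  exists y, y * x = 1.
Proof.
elim/loc_ind: x => a s na.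
have pa : a \notin p by apply/negP => pa; apply: na; exists a, s.
pose t : denom p := exist _ a pa.
exists (loc_frac (val s) t); rewrite loc_fracM; apply: loc_frac_eq => /=; ring.
Qed.

Lemma krull_dim0_minimal : krull_dim A 0 -> minimal_prime p.
Proof.
move=> [_ nchain] q qp a pa; apply: contrapT => qa; apply: nchain.
have pp : {subset p <= p} by [].
exists (fun i : 'I_2 => if i == ord0 then PrimeIdeal (prime_extension_prime qp)
                        else PrimeIdeal (prime_extension_prime pp)).
move=> [[|[|//]] i2] [[|[|//]] j2] //= _; split.
  by move=> x /asboolP[b [s [qb ->]]]; apply/asboolP; exists b, s; split=> //; apply: qp.
move=> sub; have : to_loc a \in PrimeIdeal (prime_extension_prime pp).
  by apply/asboolP; exists a, (denom1 p).
by move=> /sub/asboolP/(prime_extensionE _ _ qp).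
Qed.

Lemma span_submodule (S : comPzRingType) (M : lmodType S) (s : seq M) :
  submodule (Defs.span s).
Proof.
split=> [|a _ _ [c ->] [c' ->]].
  by exists (fun=> 0); rewrite big1 // => i _; rewrite scale0r.
exists (fun i => a * c i + c' i); rewrite scaler_sumr -big_split /=.
by apply: eq_bigr => i _; rewrite scalerDl scalerA.
Qed.

(** The first term of a regular sequence would be either a unit, making the ideal improper, or an
    element of the maximal ideal, killing [x / 1]. The latter is nonzero because everything that
    kills [x] is in [p]. *)
Lemma associated_depth0 (x : R) n :
  x <> 0 -> (forall r, r \in p <-> r * x = 0) -> local_depth A n -> n = 0%N.
Proof.
move=> x0 px [[s [sreg s1] <-] _]; case: s sreg s1 => // y s sreg s1.
have [[a [t [pa yE]]]|/not_prime_extension_unit[z zy]] := pselect (prime_extension p y).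
  case: x0; have /= := sreg 0%N isT (to_loc x).
  have -> : y * to_loc x = 0.
    rewrite yE loc_fracM; apply/loc_frac_eq0; exists 1; first exact: prime_1.
    by rewrite mul1r; apply/px.
  case=> [|c]; first exact: submod0 (span_submodule _).
  rewrite big_ord0 => /to_loc_eq0[u pu ux].
  by have /px := ux; rewrite (negPf pu).
case: s1; rewrite -zy; apply: (submodZ (span_submodule _)).
exact: (@nth_span _ _ 0).
Qed.
End LocalizationRing.

(** If [a * b] kills [y] but neither factor does, the annihilator of [b * y] is strictly larger than
    that of [y]; noetherian induction ends at a prime. *)
Lemma exists_associated_prime (R : comPzRingType) (x : R) : noetherian R -> x <> 0 ->
  exists (r : R) (q : prime_ideal R), r * x <> 0 /\ forall c, c \in q <-> c * (r * x) = 0.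
Proof.
move=> noethR x0.
have annS (y : R) : submodule (fun c : R^o => c * y = 0).
  split=> [|a c d cy dy]; first exact: mul0r.
  by rewrite mulrDl -mulrA cy dy mulr0 addr0.
suff H (J : R^o -> Prop) : submodule J ->
    forall y : R, y <> 0 -> (forall c, J c <-> c * y = 0) ->
    exists (r : R) (q : prime_ideal R), r * y <> 0 /\ forall c, c \in q <-> c * (r * y) = 0.
  exact: (H _ (annS x)).
move: J; apply: noetherian_ind => // J JS IH y y0 Jy.
have [Jp|] := pselect (forall a b, J (a * b) -> J a \/ J b).
  have JP : is_prime (fun x : R => `[< J x >]).
    split.
    - split; first exact/asboolP/(submod0 JS).
      by move=> a u v /asboolP Ju /asboolP Jv; apply/asboolP/JS.2.
    - by apply/negP => /asboolP/Jy; rewrite mul1r.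
    - by move=> a b /asboolP/Jp[] ?; apply/orP; [left|right]; apply/asboolP.
  exists 1, (PrimeIdeal JP); rewrite mul1r; split=> // c; rewrite -Jy.
  by split=> /asboolP.
move=> /existsNP[a] /existsNP[b] /not_implyP[Jab /not_orP[nJa nJb]].
have by0 : b * y <> 0 by move=> /Jy.
have [|||r [q [rby qP]]] := IH _ (annS (b * y)) _ _ (b * y) by0 => //.
- by move=> c /Jy cy; rewrite mulrCA cy mulr0.
- by exists a => //; rewrite mulrA; apply/Jy.
by exists (r * b), q; rewrite -mulrA.
Qed.

(** A zero divisor lies in an associated prime [q]. The depth at [q] is zero, hence so is the
    dimension, and [q] is minimal. *)
Lemma cohen_macaulay_regular (R : comPzRingType) (s r : R) :
  noetherian R -> cohen_macaulay R ->
  (forall p : prime_ideal R, minimal_prime p -> s \notin p) ->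
  r * s = 0 -> r = 0.
Proof.
move=> noethR CM smin rs; apply: contrapT => r0.
have [c [q [cr0 qP]]] := exists_associated_prime noethR r0.
have [n qdim /(associated_depth0 cr0 qP) n0] := CM q.
rewrite n0 in qdim; have /negP := smin _ (krull_dim0_minimal qdim); apply.
by apply/qP; rewrite mulrCA (mulrC s) rs mulr0.
Qed.

Lemma localization_local_artinian (R : comPzRingType) n (P : 'I_n -> prime_ideal R)
    (a : 'I_n -> R) N i :
  noetherian R -> minimal_splitting P a N ->
  local_artinian (prime_extension (p := P i) (P i)).
Proof.
move=> noethR Psplit; have pp : {subset P i <= P i} by [].
split.
- exact: prime_extension_submodule.
- by move=> /(prime_extensionE _ _ pp) p1; have := prime_1 (P i); rewrite p1.
- exact: not_prime_extension_unit.
- have [s ps sP] := splitting_nilpotent Psplit i.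
  have prodE (xs : seq (localization (P i))) :
      (forall x, x \in xs -> prime_extension (P i) x) ->
      exists (ys : seq R) t, [/\ size ys = size xs, forall y, y \in ys -> y \in P i &
        \prod_(x <- xs) x = loc_frac (\prod_(y <- ys) y) t].
    elim: xs => [|x xs IHxs] xsP.
      by exists [::], (denom1 (P i)); rewrite !big_nil.
    have [|ys [t [ysize ysP ysE]]] := IHxs.
      by move=> y yxs; apply: xsP; rewrite inE yxs orbT.
    have [b [u [pb xE]]] := xsP x (mem_head _ _).
    exists (b :: ys), (denomM u t); rewrite /= ysize; split=> //.
      by move=> y; rewrite inE => /predU1P[->|/ysP].
    by rewrite !big_cons ysE xE loc_fracM.
  exists N => xs xsN /prodE[ys [t [ysN ysP ->]]].
  by apply/loc_frac_eq0; exists s => //; apply: sP; rewrite ?ysN.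
- have [s sP] := noetherian_fg noethR (prime_submodule (P i)).
  exists [seq (to_loc (P i) x : (localization (P i))^o) | x <- s] => x.
  split=> [[b [t [pb ->]]]|].
    have -> : loc_frac b t = loc_frac 1 t *: (to_loc (P i) b : (localization (P i))^o).
      by rewrite [RHS]loc_fracM; apply: loc_frac_eq => /=; ring.
    apply: (submodZ (span_submodule _)).
    set gens := map _ _.
    pose J (y : R^o) := Defs.span gens (to_loc (P i) y).
    have JS : submodule J.
      split=> [|u y z].
        by rewrite /J rmorph0; apply: (submod0 (span_submodule _)).
      rewrite /J; have -> : to_loc (P i) (u *: y + z) =
          to_loc (P i) u *: (to_loc (P i) y : (localization (P i))^o) + to_loc (P i) z.
        by rewrite rmorphD; congr (_ + _); apply: rmorphM.
      exact: (span_submodule gens).2.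
    apply: (mem_span JS) ((sP b).1 pb) => j js.
    rewrite /J -(nth_map _ 0 (fun x => to_loc (P i) x)) //.
    by apply: nth_span; rewrite size_map.
  apply: (mem_span (prime_extension_submodule _ _)) => j; rewrite size_map => js.
  rewrite (nth_map 0) //; apply/(prime_extensionE _ _ pp)/sP.
  exact: nth_span.
Qed.

(** * Localized modules as quotients by torsion *)

Section LocalModule.
Variables (R : comPzRingType) (p : prime_ideal R).
Local Notation A := (localization p).

Definition denominators_invertible (M : lmodType R) : Prop :=
  forall s, s \notin p ->
    (forall x : M, s *: x = 0 -> x = 0) /\ (forall x : M, exists y, s *: y = x).

Section Construction.
Variables (M : lmodType R) (Minv : denominators_invertible M).

Definition local_module of denominators_invertible M : Type := M.
Local Notation LM := (local_module Minv).
HB.instance Definition _ := GRing.Zmodule.on LM.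

(** The fraction [r / t] acts by the unique [y] with [t y = r x]; [local_scaleP] frees this from the
    chosen representative. *)
Definition local_scale (a : A) (x : LM) : LM :=
  projT1 (cid ((Minv (valP (repr a).2)).2 ((repr a).1 *: (x : M)))).

Lemma local_scaleP (r : R) (t : denom p) (x y : M) :
  val t *: y = r *: x <-> local_scale (loc_frac r t) x = y.
Proof.
have inj s (z z' : M) : s \notin p -> s *: z = s *: z' -> z = z'.
  move=> ps e; apply/subr0_eq; apply: (Minv ps).1.
  by rewrite scalerBr e subrr.
have tP := projT2 (cid ((Minv (valP (repr (loc_frac r t)).2)).2
  ((repr (loc_frac r t)).1 *: x))).
have {tP} : val t *: (local_scale (loc_frac r t) x : M) = r *: x.
  move: tP; rewrite -/(local_scale _ x); case: (repr _) (loc_repr r t) => r' [t' pt'].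
  move=> [u pu /= e] t'E; apply: (inj (u * t')); first exact: denomMP.
  have -> z : (u * t') *: (val t *: z : M) = (u * val t) *: (t' *: z).
    by rewrite !scalerA; congr (_ *: _); ring.
  rewrite t'E !scalerA; congr (_ *: _).
  by rewrite -mulrA (mulrC (val t)) e; ring.
move=> tE; split=> [e|<- //]; apply: (inj (val t)); first exact: valP t.
by rewrite tE.
Qed.

Lemma local_scaleK (r : R) (t : denom p) (x : LM) :
  val t *: (local_scale (loc_frac r t) x : M) = r *: (x : M).
Proof. exact/local_scaleP. Qed.

Let scale_mul (r r' s s' : R) (x y z : M) : s *: z = r *: y -> s' *: y = r' *: x ->
  (s * s') *: z = (r * r') *: x.
Proof.
by move=> e e'; rewrite (mulrC s) -!scalerA e -e' !scalerA mulrC.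
Qed.

Let scale_add (r r' s s' : R) (x z z' : M) : s *: z = r *: x -> s' *: z' = r' *: x ->
  (s * s') *: (z + z') = (r * s' + r' * s) *: x.
Proof.
move=> e e'; rewrite scalerDr {1}(mulrC s) -!scalerA e e' !scalerA -scalerDl.
by rewrite (mulrC s') (mulrC s).
Qed.

Lemma local_scaleA a c (x : LM) :
  local_scale a (local_scale c x) = local_scale (a * c) x.
Proof.
elim/loc_ind: a => r s; elim/loc_ind: c => r' s'.
rewrite loc_fracM; apply/esym/local_scaleP => /=.
exact: (scale_mul (local_scaleK _ _ _) (local_scaleK _ _ _)).
Qed.
Lemma local_scale1 : left_id 1 local_scale.
Proof. by move=> x; apply/local_scaleP. Qed.
Lemma local_scaleDr : right_distributive local_scale +%R.
Proof.
move=> a x y; elim/loc_ind: a => r s; apply/local_scaleP.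
have e := local_scaleK r s x; have e' := local_scaleK r s y.
by rewrite [LHS](@scalerDr _ M) e e' -[LHS](@scalerDr _ M).
Qed.
Lemma local_scaleDl x : {morph local_scale^~ x : a c / a + c}.
Proof.
move=> a c; elim/loc_ind: a => r s; elim/loc_ind: c => r' s'.
rewrite loc_fracD; apply/local_scaleP => /=.
exact: (scale_add (local_scaleK _ _ _) (local_scaleK _ _ _)).
Qed.
HB.instance Definition _ := GRing.Zmodule_isLmodule.Build A LM
  local_scaleA local_scale1 local_scaleDr local_scaleDl.

Lemma to_local_linear :
  linear (id : M -> restrict (to_loc p) (LM : lmodType A)).
Proof.
move=> r x y /=; congr (_ + _); apply/esym.
by apply/local_scaleP; rewrite /= scale1r.
Qed.
End Construction.

Section Torsion.
Variable M : lmodType R.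

Definition torsion (x : M) : Prop := exists2 u, u \notin p & u *: x = 0.

Lemma torsion_submodule : submodule torsion.
Proof.
split=> [|a x y [u pu ux] [v pv vy]].
  by exists 1; [apply: prime_1 | rewrite scaler0].
exists (u * v); first exact: denomMP.
rewrite scalerDr -[X in _ + X]scalerA vy scaler0 addr0.
have -> : (u * v) *: (a *: x) = (v * a) *: (u *: x).
  by rewrite !scalerA; congr (_ *: _); ring.
by rewrite ux scaler0.
Qed.

Lemma exists_localization :
  (forall s, s \notin p -> forall x : M, exists y, torsion (x - s *: y)) ->
  exists (J : lmodType A) (k : {linear M -> restrict (to_loc p) J}),
    (forall y, exists x, k x = y) /\ (forall x, k x = 0 <-> torsion x).
Proof.
move=> Mdiv; pose Q := quotient_module torsion_submodule.
pose q : {linear M -> Q} := linear_of (to_quotient_linear torsion_submodule).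
have q0 x : q x = 0 <-> torsion x.
  by rewrite -(linear0 q) [q x = _]to_quotientP subr0.
have Qinv : denominators_invertible Q.
  move=> s ps; split=> x; have [y <-] := to_quotient_onto x.
    rewrite -[to_quotient _ y]/(q y) -linearZ /= => /q0[u pu uy].
    by apply/q0; exists (u * s); [apply: denomMP | rewrite -scalerA].
  have [z yz] := Mdiv s ps y; exists (q z); rewrite -linearZ /=.
  by apply/esym/to_quotientP.
exists (local_module Qinv), (linear_of (to_local_linear Qinv) \o q).
split=> [y|x]; last exact: q0.
by have [x xy] := to_quotient_onto (y : Q); exists x.
Qed.
End Torsion.

Lemma loc_cancel (E : lmodType A) (s : R) (x y : E) :
  s \notin p -> to_loc p s *: x = to_loc p s *: y -> x = y.
Proof.
move=> ps e; pose t : denom p := exist _ s ps.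
by rewrite -[x]scale1r -[y]scale1r -(loc_unit t) -!scalerA /= e.
Qed.

(** A map [G] on an ideal of [R] is extended to fractions: [r / s] goes to [z] when [G] relates [r]
    to [s z]. *)
Lemma restrict_ideal_injective (E : lmodType A) :
  ideal_injective E -> ideal_injective (restrict (to_loc p) E : lmodType R).
Proof.
move=> Einj G GL.
have [|e eP] := Einj (fun c z => exists2 s, s \notin p &
    exists2 r, to_loc p s * c = to_loc p r & G r (to_loc p s *: z)).
  split.
  - exists 1; first exact: prime_1.
    by exists 0; rewrite ?mulr0 ?rmorph0 ?scaler0 //; exact: (graph0 GL).
  - move=> a c z c' z' [s ps [r rE Gr]] [s' ps' [r' rE' Gr']].
    elim/loc_ind: a => b t.
    exists (val t * (s * s')); first exact: denomMP (valP t) (denomMP ps ps').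
    have K := loc_fracK b t.
    exists (b * s' * r + val t * s * r').
      suff : to_loc p (val t * (s * s')) * (loc_frac b t * (c : A) + (c' : A)) =
          to_loc p (b * s' * r + val t * s * r') :> A by [].
      rewrite !(rmorphD, rmorphM) /= -K -rE -rE'. ring.
    have -> : to_loc p (val t * (s * s')) *: (loc_frac b t *: z + z') =
        to_loc p (b * s') *: (to_loc p s *: z) +
        to_loc p (val t * s) *: (to_loc p s' *: z').
      rewrite scalerDr !scalerA; congr (_ *: _ + _ *: _).
        by rewrite !rmorphM /= -K; ring.
      by rewrite !rmorphM /=; ring.
    exact: (graphD GL (graphZ GL (b * s') Gr) (graphZ GL (val t * s) Gr')).
  - move=> z [s ps [r rE Gr]].
    have /esym/to_loc_eq0[u pu ur] : 0 = to_loc p r by rewrite -rE mulr0.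
    apply: (loc_cancel ps); apply: (loc_cancel pu); rewrite !scaler0.
    have := graphZ GL u Gr; rewrite [u *: _]ur => Gu.
    exact: (graph_fun GL Gu (graph0 GL)).
exists e => c z Gz; apply: (eP (to_loc p c) z).
exists 1; first exact: prime_1.
by exists c; rewrite rmorph1 ?mul1r ?scale1r.
Qed.
End LocalModule.

(** * Modules over the localizations at minimal primes *)

Section LocalTransfer.
Variables (R : comPzRingType) (p : prime_ideal R).
Local Notation A := (localization p).
Local Notation res := (restrict (to_loc p)).

(** Denominators cancel in [N], so [R]-linearity already forces linearity over the localization. *)
Lemma restrict_linearA (M N : lmodType A)
    (g : {linear (res M : lmodType R) -> (res N : lmodType R)}) :
  linear (g : M -> N).
Proof.
move=> a x y; rewrite -[_ + y]/((a *: x : res M) + (y : res M)) raddfD; congr (_ + _).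
elim/loc_ind: a => r s; apply: (loc_cancel (valP s)).
have gZ (c : R) (z : M) : to_loc p c *: (g z : N) = g (to_loc p c *: z).
  have e := linearZ_LR g c z; exact: (esym e).
by rewrite gZ !scalerA loc_fracK gZ.
Qed.

Lemma prod_notin (I : Type) (s : seq I) (F : I -> R) :
  (forall i, F i \notin p) -> \prod_(i <- s) F i \notin p.
Proof.
move=> Fp; elim/big_rec: _ => [|i x _ px]; first exact: prime_1.
exact: denomMP.
Qed.

Section Localized.
Variables (I : lmodType R) (J : lmodType A)
  (k : {linear I -> (res J : lmodType R)}).
Hypotheses (k_onto : forall y, exists x, k x = y)
  (k_ker : forall x, k x = 0 <-> torsion p x).

Lemma localized_linear_map (N : lmodType A)
    (h : {linear I -> (res N : lmodType R)}) :
  exists g : {linear J -> N}, forall x, g (k x) = h x.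
Proof.
have kh x y : k x = k y -> h x = h y.
  move=> e; have /k_ker[u pu uxy] : k (x - y) = 0 by rewrite linearB e subrr.
  apply: (loc_cancel pu); apply/subr0_eq; rewrite -scalerBr.
  have := linearZ_LR h u (x - y); rewrite uxy linear0 linearB => e0.
  by rewrite [RHS]e0.
have [g gP] := choice k_onto.
have fL : linear (h \o g : (res J : lmodType R) -> (res N : lmodType R)).
  move=> a x y; rewrite /= -linearP; apply: kh.
  by rewrite gP linearP !gP.
exists (linear_of (restrict_linearA (linear_of fL))) => x.
exact/kh/gP.
Qed.

(** The annihilator of [p] in [R] maps into the socle of the localization, so it kills a multiple
    [u *: x] of a preimage of [y], with [u] outside [p]. Injectivity of [I] then writes [u *: x] as
    a combination of generators of [p], and dividing by [u] gives the claim for [y]. *)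
Lemma localized_socle_divisible : noetherian R -> injective_module I ->
  socle_divisible (prime_extension p) J.
Proof.
move=> noethR Iinj y ysoc; have [x kx] := k_onto y.
have kZ (c : R) (z : I) : k (c *: z) = to_loc p c *: (k z : J).
  have e := linearZ_LR k c z; exact: e.
have [s sP] := noetherian_fg noethR (prime_submodule p).
pose ann (c : R^o) := forall i : 'I_(size s), c * s`_i = 0.
have annS : submodule ann.
  split=> [i|a c d cs ds i]; first by rewrite mul0r.
  by rewrite mulrDl -mulrA cs ds mulr0 addr0.
have [t tP] := noetherian_fg noethR annS.
(* Each generator of the annihilator of [p] kills [x] up to torsion; indices past the end of [t] get
   the default [1]. *)
have tx i : exists u, u \notin p /\ ((i < size t)%N -> u *: (t`_i *: x) = 0).
  have [it|_] := ltnP i (size t); last by exists 1; split=> //; apply: prime_1.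
  suff /k_ker[u pu ux] : k (t`_i *: x) = 0 by exists u.
  rewrite kZ kx; apply: ysoc => _ [a [v [pa ->]]].
  rewrite [_ * _]loc_fracM; apply/loc_frac_eq0; exists 1; first exact: prime_1.
  rewrite mul1r mulrC; have [c ->] := (sP a).1 pa.
  rewrite mulr_sumr big1 // => j _; rewrite mulrCA.
  by have -> := (tP t`_i).2 (nth_span it) j; rewrite mulr0.
have [f fP] := choice tx.
pose u := \prod_(i < size t) f i.
have pu : u \notin p by apply: prod_notin => i; case: (fP i).
have uann c : ann c -> c *: (u *: x) = 0.
  move=> /tP; pose K (c : R^o) := (c : R) *: (u *: x) = 0.
  have KS : submodule K.
    split=> [|a b d bx dx]; first exact: scale0r.
    by rewrite /K scalerDl -[a *: b]/(a * b) -scalerA bx dx scaler0 addr0.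
  apply: (mem_span KS) => i it; rewrite /K /u (bigD1 (Ordinal it)) //=.
  set v := \prod_(_ < _ | _) _.
  have -> : (t`_i : R) *: ((f i * v) *: x) = v *: (f i *: (t`_i *: x)).
    by rewrite !scalerA; congr (_ *: _); ring.
  by have [_ ->] := fP i; rewrite ?scaler0.
have [c cs|z uz] := injective_divisible
    (y := fun i : 'I_(size s) => s`_i) Iinj (x := u *: x).
  exact: uann.
pose v : denom p := exist _ u pu.
exists (size s), (fun i => @loc_frac R p s`_i v), (fun i => k (z i)); split.
  by move=> i; exists s`_i, v; split=> //; apply/sP/nth_span.
apply: (loc_cancel pu); rewrite -kx -kZ uz linear_sum scaler_sumr.
by apply: eq_bigr => i _; rewrite kZ scalerA (loc_fracK _ v).
Qed.
End Localized.

Hypothesis Aloc : local_artinian (prime_extension p : A -> Prop).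
Hypothesis Ainj : ideal_injective A^o.
Hypothesis noethR : noetherian R.
Hypothesis div : forall I : lmodType R, injective_module I ->
  forall s, s \notin p -> forall x : I, exists y, torsion p (x - s *: y).

(** A map from [I] to a module over the localization factors through the localization [J] of [I],
    where [socle_divisible_lift] applies. *)
Lemma restrict_injective_lift (M N : lmodType A) (f : {linear M -> N}) :
  injective_lift (restrict_map (to_loc p) f).
Proof.
move=> I h Iinj fh; have [J [k [k_onto k_ker]]] := exists_localization (div Iinj).
have [g gP] := localized_linear_map k_onto k_ker h.
have [sigma [s0 sP]] := exists_socle Aloc.
have Jdiv := localized_socle_divisible k_onto k_ker noethR Iinj.
have [y|l lP] := socle_divisible_lift Aloc s0 sP (d := f) (h := g) Ainj Jdiv.
  by have [x <-] := k_onto y; have [z fz] := fh x; exists z; rewrite gP.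
exists (restrict_map (to_loc p) l \o k) => x.
by rewrite -gP -lP.
Qed.

Lemma restrict_injective (M : lmodType A) :
  ideal_injective M -> injective_module (res M : lmodType R).
Proof. by move=> Minj; apply/injective_moduleP/restrict_ideal_injective. Qed.

Lemma restrict_gorenstein_injective (M : lmodType A) :
  gorenstein_injective (res M : lmodType R).
Proof.
have [N [dN [e [e_onto dN0 dN_exact N_inj]]]] := left_resolution Aloc M Ainj.
have [P [dP [u [u_inj dP0 dP_exact P_inj]]]] := right_resolution Aloc M Ainj.
have dc0 : exact (dN 0%N) (u \o e).
  move=> y; rewrite -dN0; split=> /= [uy|->]; last exact: linear0.
  by apply: u_inj; rewrite linear0.
have dcP : exact (u \o e) (dP 0%N).
  move=> y; rewrite dP0; split=> -[x <-]; last by exists (e x).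
  by have [z <-] := e_onto x; exists z.
apply: (splice_gorenstein_injective
  (N := fun n => res (N n) : lmodType R) (P := fun n => res (P n) : lmodType R)
  (dN := fun n => restrict_map (to_loc p) (dN n))
  (dc := restrict_map (to_loc p) (u \o e))
  (dP := fun n => restrict_map (to_loc p) (dP n))
  _ _ _ _ _ _ _ _ _ (u := restrict_map (to_loc p) u)) => //.
- by move=> n; apply: restrict_injective_lift.
- exact: restrict_injective_lift.
- by move=> n; apply: restrict_injective_lift.
- by move=> n; apply: restrict_injective.
- by move=> n; apply: restrict_injective.
move=> y; split=> -[x <-]; last by exists (e x).
by have [z <-] := e_onto x; exists z.
Qed.
End LocalTransfer.

(** * Separating the minimal primes on a module *)

Section Splitting.
Variables (R : comPzRingType) (n : nat) (P : 'I_n -> prime_ideal R) (a : 'I_n -> R).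
Variables (N : nat) (Psplit : minimal_splitting P a N).

(** Modulo [P i] only the term [a i * b i] survives. *)
Lemma splitting_sum_notin (b : 'I_n -> R) i :
  b i \notin P i -> \sum_j a j * b j \notin P i.
Proof.
move=> bi; rewrite (bigD1 i) //=; apply/negP => sP.
have others : \sum_(j < n | j != i) a j * b j \in P i.
  elim/big_rec: _ => [|j x ji Px]; first exact: (submod0 (prime_submodule _)).
  apply: (submodD (prime_submodule (P i))) => //; apply: prime_mulr.
  by apply: (splitting_in Psplit); apply/eqP.
have /prime_mul[] : a i * b i \in P i.
- by have := submodB (prime_submodule (P i)) sP others; rewrite /= addrK.
- by apply/negP/(splitting_notin Psplit).
- exact/negP.
Qed.

Lemma splitting_mul_sum (M : lmodType R) (b : 'I_n -> M) i :
  a i *: (\sum_j a j *: b j) = (a i * a i) *: b i.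
Proof.
rewrite scaler_sumr (bigD1 i) //= scalerA big1 ?addr0 // => j /eqP ji.
by rewrite scalerA (splitting_orthogonal Psplit) ?scale0r // => /esym.
Qed.

Lemma splitting_sqr_notin i : a i * a i \notin P i.
Proof. by apply: denomMP; apply: splitting_notin Psplit _. Qed.

Variable M : lmodType R.
Hypothesis Mdiv : forall s, (forall i, s \notin P i) ->
  forall x : M, exists y, s *: y = x.

Lemma splitting_divisible i s : s \notin P i ->
  (* [s] is known to avoid [P i] only. Adding the other [a j] to [a i * s] gives an element that
     avoids all the primes and becomes [a i * a i * s] when multiplied by [a i]. *)
  forall x : M, exists y, torsion (P i) (x - s *: y).
Proof.
move=> sP x; pose b j := if j == i then s else 1.
have [j|y <-] := Mdiv (s := \sum_j a j * b j) _ x.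
  by apply: splitting_sum_notin; rewrite /b; case: eqP => [->|_] //; apply: prime_1.
exists (a i *: y), (a i); first exact: splitting_notin Psplit _.
rewrite scalerBr scaler_suml.
under eq_bigr do rewrite -scalerA.
rewrite splitting_mul_sum /b eqxx !scalerA.
by apply/eqP; rewrite subr_eq0; apply/eqP; congr (_ *: _); ring.
Qed.

Hypothesis Mreg : forall s, (forall i, s \notin P i) ->
  forall x : M, s *: x = 0 -> x = 0.

(** A difference killed by some [u i] outside each [P i] is killed by [\sum_j a j * u j], which acts
    injectively. For surjectivity, components [x j] are glued by solving
    [(\sum_j a j) z = \sum_j a j *: x j]: multiplication by [a i] shows that [z] and [x i] agree up
    to torsion at [P i]. *)
Lemma splitting_decomposition (J : 'I_n -> lmodType R)
    (k : forall i, {linear M -> J i}) :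
  (forall i y, exists x, k i x = y) -> (forall i x, k i x = 0 <-> torsion (P i) x) ->
  injective (pairing k) /\ forall y, exists x, pairing k x = y.
Proof.
move=> k_onto k_ker; split.
  move=> x y e; apply/subr0_eq.
  have /choice[u uP] i : exists u, u \notin P i /\ u *: (x - y) = 0.
    have /k_ker[u] : k i (x - y) = 0; last by exists u.
    by rewrite linearB -[k i x]/(pairing k x i) e subrr.
  apply: (Mreg (s := \sum_j a j * u j)).
    by move=> i; apply: splitting_sum_notin; case: (uP i).
  by rewrite scaler_suml big1 // => i _; rewrite -scalerA (uP i).2 scaler0.
move=> y; have [x xy] := choice (fun i => k_onto i (y i)).
have [i|z zx] := Mdiv (s := \sum_j a j * 1) _ (\sum_j a j *: x j).
  by apply: splitting_sum_notin; apply: prime_1.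
exists z; apply: functional_extensionality_dep => i.
rewrite /pairing -xy; apply/subr0_eq; rewrite -linearB; apply/k_ker.
exists (a i * a i); first exact: splitting_sqr_notin.
rewrite scalerBr -(splitting_mul_sum x) -zx scaler_suml.
under eq_bigr do rewrite -scalerA scale1r.
by rewrite splitting_mul_sum subrr.
Qed.
End Splitting.

Section TensorBijective.
Variables (R : comPzRingType) (G H : lmodType R) (s : R).
Hypotheses (Gdiv : forall g : G, exists g', g = s *: g')
  (Hdiv : forall h : H, exists h', h = s *: h').

(** A section [q] of multiplication by [s] on [G] need not be additive, but different choices of
    preimage agree after tensoring; so [tens (q g) h] is bilinear and induces an inverse of [s]. *)
Lemma tensor_scale_bijective :
  (forall x : tensor G H, exists y, s *: y = x) /\
  (forall x : tensor G H, s *: x = 0 -> x = 0).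
Proof.
have [tl tr] := tens_bilinear G H.
have tZl c g h : tens (c *: g) h = c *: tens g h :> tensor G H.
  exact: (linearZ_LR (linear_of (tl h))).
have tZr c g h : tens g (c *: h) = c *: tens g h :> tensor G H.
  exact: (linearZ_LR (linear_of (tr g))).
have tDl g g' h : tens (g + g') h = tens g h + tens g' h :> tensor G H.
  exact: (linearD (linear_of (tl h))).
have [q qP] := choice Gdiv.
(* [s g = 0] forces [g (x) h = g (x) s h' = 0]. *)
have tq g g' h : s *: g = g' -> tens (q g') h = tens g h :> tensor G H.
  move=> e; have [h' ->] := Hdiv h.
  by rewrite !tZr -!tZl -qP e.
have qB : bilinear_map (fun g h => tens (q g) h : tensor G H).
  split=> [h a g g'|g]; last exact: tr.
  rewrite (tq (a *: q g + q g')) ?tDl ?tZl //.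
  by rewrite scalerDr scalerA mulrC -scalerA -!qP.
have [f [fP _]] := tensor_universal qB.
have sf x : s *: f x = x.
  rewrite (tensor_sumE x) /tsum (linear_sum f) scaler_sumr.
  by apply: eq_bigr => u _; rewrite fP -tZl -qP.
split=> x; first by exists (f x); apply: sf.
by move=> sx; rewrite -(sf x) -linearZ /= sx linear0.
Qed.
End TensorBijective.

Theorem theorem2 (R : comPzRingType) (D : lmodType R) :
  noetherian R ->
  cohen_macaulay R ->
  dualizing_module D ->
  generically_gorenstein R ->
  forall G H : lmodType R,
    gorenstein_injective G -> gorenstein_injective H ->
    gorenstein_injective (tensor G H).
Proof.
move=> noethR CM _ gen G H GG GH.
have [n [P [a [N Psplit]]]] := exists_minimal_splitting noethR.
have reg s : (forall i, s \notin P i) -> forall r, r * s = 0 -> r = 0.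
  move=> sP r; apply: cohen_macaulay_regular => // p pmin.
  have [i pP] := splitting_complete Psplit pmin.
  by apply: contra (sP i) => /pP.
have tens_bij s : (forall i, s \notin P i) ->
    (forall x : tensor G H, exists y, s *: y = x) /\
    (forall x : tensor G H, s *: x = 0 -> x = 0).
  by move=> /reg sreg; apply: tensor_scale_bijective => x;
     apply: gorenstein_injective_divisible.
have local_GI i (M : lmodType (localization (P i))) :
    gorenstein_injective (restrict (to_loc (P i)) M : lmodType R).
  have Aloc := localization_local_artinian i noethR Psplit.
  have [sigma [s0 sP]] := exists_socle Aloc.
  apply: (restrict_gorenstein_injective Aloc) => //.
    apply: (residue_ideal_injective Aloc).
    apply: (finite_injdim_residue_injective Aloc s0 sP).
    exact/gen/(splitting_minimal Psplit).
  (* Regular elements act surjectively on [I]; the splitting transfers this, up to torsion, to every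
     element outside [P i]. *)
  move=> I Iinj; apply: (splitting_divisible Psplit) => s /reg sreg x.
  have [|z xz] := injective_divisible (y := fun _ : 'I_1 => s) Iinj (x := x).
    by move=> c /(_ ord0)/sreg ->; rewrite scale0r.
  by exists (z ord0); rewrite xz big_ord1.
have loc i := exists_localization (splitting_divisible (i := i) Psplit
  (fun s sP => (tens_bij s sP).1)).
have /all_sig[J JP] i := cid (loc i).
have {JP loc} /all_sig[k kP] i := cid (JP i).
have [kinj konto] := splitting_decomposition Psplit
  (fun s sP => (tens_bij s sP).1) (fun s sP => (tens_bij s sP).2)
  (fun i => (kP i).1) (fun i => (kP i).2).
apply: (gorenstein_injective_iso (f := linear_of (pairing_linear k))) => //.
by apply: gorenstein_injective_product => i; apply: local_GI.
Qed.
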